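(* Let $\mathscr S$ be an operator system, let $\mathscr T$ be a unital $C^*$-algebra, and let $\mathcal K,\mathcal L\subseteq\mathrm{CP}(\mathscr S,\mathscr T)$. Then $$\overline{\mathrm{cconv}(\mathcal K)}^{\,\tau}=\overline{\mathrm{cconv}(\mathcal L)}^{\,\tau}$$ if and only if $h_{\mathcal K}(k,f,s)=h_{\mathcal L}(k,f,s)$ for every matrix test $(k,f,s)$.
   Context: Unital $C^*$-algebras are assumed nonzero ($\mathbb 1\neq 0$). $\mathrm{CP}(\mathscr S,\mathscr T)$ is the set of all completely positive linear maps $\mathscr S\to\mathscr T$. For a linear map $\Phi:\mathscr S\to\mathscr T$ and $k\in\mathbb N$ ($k\ge1$), $\Phi_k:M_k(\mathscr S)\to M_k(\mathscr T)$ is the ampliation $\Phi_k([s_{ij}])=[\Phi(s_{ij})]$. A $C^*$-convex combination of $\Phi_1,\dots,\Phi_n\in \mathrm{CP}(\mathscr S,\mathscr T)$ is a map $\sum_{i=1}^n a_i^*\Phi_i(\cdot)a_i$ with $a_i\in\mathscr T$ and $\sum_{i=1}^n a_i^*a_i=\mathbb 1_{\mathscr T}$ ($n\ge 1$). A subset of $\mathrm{CP}(\mathscr S,\mathscr T)$ is $C^*$-convex if it is closed under all such finite combinations of its elements; $\mathrm{cconv}(\mathcal K)$ is the smallest $C^*$-convex subset of $\mathrm{CP}(\mathscr S,\mathscr T)$ containing $\mathcal K$ (so $\mathrm{cconv}(\varnothing)=\varnothing$). A matrix test is a triple $(k,f,s)$ with $k\in\mathbb N$, $f$ a state on $M_k(\mathscr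 T)$ (positive linear functional with $f(\mathbb 1)=1$), and $s\in M_k(\mathscr S)$. $\mathcal E=\mathrm{span}_{\mathbb C}(\mathrm{CP}(\mathscr S,\mathscr T))$, a complex vector space of linear maps $\mathscr S\to\mathscr T$. $\tau$ is the locally convex topology on $\mathcal E$ generated by the seminorms $p_{k,f,s}(\Phi)=|f(\Phi_k(s))|$ over all matrix tests $(k,f,s)$, and $\overline{\,\cdot\,}^{\,\tau}$ is $\tau$-closure in $\mathcal E$. The support function of $\mathcal K\subseteq\mathrm{CP}(\mathscr S,\mathscr T)$ is $h_{\mathcal K}(k,f,s)=\sup_{\Psi\in\mathrm{cconv}(\mathcal K)}\Re f(\Psi_k(s))\in[-\infty,\infty]$, with $\sup\varnothing=-\infty$. *)

(* Defs.v *)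
From HB Require Import structures.
From mathcomp Require Import all_boot all_order all_algebra.
From mathcomp Require Import complex.
From mathcomp Require Import all_classical all_reals all_analysis.
Set Implicit Arguments.
Unset Strict Implicit.
Unset Printing Implicit Defensive.
Import Order.TTheory GRing.Theory Num.Theory.
Import numFieldNormedType.Exports.
Local Open Scope classical_set_scope.
Local Open Scope ring_scope.

(* Unital C*-algebras over R[i]; nonzero, since GRing.Algebra requires 1 != 0.
   The norm is a field of this structure because the library's normed modules
   cannot be joined with its algebras (the join would have to precede
   Num.NumDomain in the hierarchy). *)
HB.mixin Record isCStarAlgebra (R : realType) T of GRing.Algebra R[i] T := {
  cnorm : T -> R;
  star : T -> T;
  cnorm_eq0 : forall x : T, cnorm x = 0 -> x = 0;
  cnormD : forall x y : T, cnorm (x + y) <= cnorm x + cnorm y;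
  cnormZ : forall (c : R[i]) (x : T), cnorm (c *: x) = Normc.normc c * cnorm x;
  cnormM : forall x y : T, cnorm (x * y) <= cnorm x * cnorm y;
  cnorm_complete : forall u : nat -> T,
    (forall e : R, 0 < e -> exists N : nat, forall m n : nat,
       (N <= m)%N -> (N <= n)%N -> cnorm (u m - u n) < e) ->
    exists l : T, cnorm (u n - l) @[n --> \oo] --> (0 : R);
  starK : involutive star;
  starD : {morph star : x y / x + y};
  starZ : forall (c : R[i]) (x : T), star (c *: x) = conjc c *: star x;
  starM : forall x y : T, star (x * y) = star y * star x;
  cnorm_star : forall x : T, cnorm (star x * x) = cnorm x ^+ 2
}.

#[short(type="cstarAlgType")]
HB.structure Definition CStarAlgebra (R : realType) :=
  {T of GRing.Algebra R[i] T & isCStarAlgebra R T}.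

Section MatrixPositivity.
Context {R : realType} {T : cstarAlgType R}.

Definition mx_star m n (M : 'M[T]_(m, n)) : 'M[T]_(n, m) :=
  (map_mx star M)^T.

(* The positive elements of the C*-algebra M_k(T) are the y^* y. *)
Definition mx_positive k (M : 'M[T]_k) : Prop :=
  exists N : 'M[T]_k, M = mx_star N *m N.

(* 'M[T]_k carries only the T-scaling in the library, hence the entrywise
   scaling by complex numbers. *)
Definition is_state k (f : 'M[T]_k -> R[i]) : Prop :=
  [/\ forall (c : R[i]) (M N : 'M[T]_k),
        f (map_mx ( *:%R c) M + N) = c * f M + f N,
      forall M : 'M[T]_k, mx_positive M -> 0 <= f M
    & f 1%:M = 1].

End MatrixPositivity.

(* Operator systems: unital self-adjoint linear subspaces of a unital
   C*-algebra. *)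
Record opSystem (R : realType) (A : cstarAlgType R) := OpSystem {
  os_pred :> {pred A};
  os_submod : submod_closed os_pred;
  os_one : 1 \in os_pred;
  os_star : forall x : A, x \in os_pred -> star x \in os_pred
}.

Section OpSystemSort.
Context {R : realType} {A : cstarAlgType R}.

HB.instance Definition _ (S : opSystem A) :=
  GRing.isSubmodClosed.Build R[i] A (os_pred S) (os_submod S).

Record os_sort (S : opSystem A) := OsElt {
  os_val : A;
  os_valP : os_val \in os_pred S
}.

Section Instances.
Variable S : opSystem A.
HB.instance Definition _ := [isSub for @os_val S].
HB.instance Definition _ := [Choice of os_sort S by <:].
HB.instance Definition _ :=
  [SubChoice_isSubLmodule of os_sort S by <:].
End Instances.

End OpSystemSort.

Coercion os_sort : opSystem >-> Sortclass.

Section CPMaps.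
Context {R : realType} {A T : cstarAlgType R}.
Variable S : opSystem A.

(* The cone of M_k(S) is that of M_k(A), intersected with M_k(S). *)
Definition os_mx_positive k (M : 'M[S]_k) : Prop :=
  mx_positive (map_mx (@os_val _ _ S) M).

(* The ampliation of Phi is [map_mx Phi]. *)
Definition CP : set (S -> T) :=
  [set Phi | linear Phi /\
    forall k, (0 < k)%N -> forall M : 'M[S]_k,
      os_mx_positive M -> mx_positive (map_mx Phi M)].

Definition cstar_comb n (a : 'I_n -> T) (Phi : 'I_n -> (S -> T)) : S -> T :=
  fun s => \sum_(i < n) star (a i) * Phi i s * a i.

Definition cstar_convex (X : set (S -> T)) : Prop :=
  X `<=` CP /\
  forall n (a : 'I_n -> T) (Phi : 'I_n -> (S -> T)), (0 < n)%N ->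
    (forall i, X (Phi i)) -> \sum_(i < n) star (a i) * a i = 1 ->
    X (cstar_comb a Phi).

Definition cconv (K : set (S -> T)) : set (S -> T) := smallest cstar_convex K.

Record matrix_test := MatrixTest {
  mt_k : nat;
  mt_k_gt0 : (0 < mt_k)%N;
  mt_f : 'M[T]_mt_k -> R[i];
  mt_state : is_state mt_f;
  mt_s : 'M[S]_mt_k
}.

Definition test_eval (t : matrix_test) (Phi : S -> T) : R[i] :=
  mt_f (map_mx Phi (mt_s t)).

Definition test_seminorm (t : matrix_test) (Phi : S -> T) : R :=
  Normc.normc (test_eval t Phi).

Definition support_fun (K : set (S -> T)) (t : matrix_test) : \bar R :=
  ereal_sup [set (complex.Re (test_eval t Psi))%:E | Psi in cconv K].

Definition cp_span : set (S -> T) :=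
  [set Phi | exists n (c : 'I_n -> R[i]) (Psi : 'I_n -> (S -> T)),
    (forall i, CP (Psi i)) /\ Phi = \sum_(i < n) c i *: Psi i].

Definition cp_span_pred : {pred S -> T} := mem cp_span.

Lemma cp_span_submod : submod_closed cp_span_pred.
Proof.
split=> [|a f g]; rewrite !inE.
  by exists 0%N, (fun=> 0), (fun=> 0); split; [case | rewrite big_ord0].
move=> [n [c [F [FCP ->]]]] [m [d [G [GCP ->]]]].
exists (n + m)%N.
exists (fun i : 'I_(n + m) =>
  match fintype.split i with inl j => a * c j | inr j => d j end).
exists (fun i : 'I_(n + m) =>
  match fintype.split i with inl j => F j | inr j => G j end).
split=> [i|]; first by case: (fintype.split i).
rewrite big_split_ord scaler_sumr; congr (_ + _); apply: eq_bigr => i _.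
  by case: split_ordP => j /eqP; rewrite ?eq_lshift ?eq_lrshift // => /eqP ->;
     rewrite scalerA.
by case: split_ordP => j /eqP; rewrite ?eq_rshift ?eq_rlshift // => /eqP ->.
Qed.

HB.instance Definition _ :=
  GRing.isSubmodClosed.Build R[i] (S -> T) cp_span_pred cp_span_submod.

Record Espace := EElt {
  E_val :> S -> T;
  E_valP : E_val \in cp_span_pred
}.
HB.instance Definition _ := [isSub for E_val].
HB.instance Definition _ := [Choice of Espace by <:].
HB.instance Definition _ := [SubChoice_isSubLmodule of Espace by <:].

(* The locally convex topology generated by the seminorms: the open seminorm
   balls, around all centers, form a subbase. *)
Definition tau_balls : set (set Espace) :=
  [set B | exists (t : matrix_test) (Phi0 : Espace) (e : R),
    0 < e /\ B = [set Phi : Espace | test_seminorm t (Phi - Phi0) < e]].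

HB.instance Definition _ := isSubBaseTopological.Build Espace tau_balls id.

(* The closure in Espace of (the elements of Espace in) X. *)
Definition tau_closure (X : set (S -> T)) : set Espace :=
  closure [set Phi : Espace | X Phi].

End CPMaps.

Arguments CP {R A} T S.

(* Main.v *)
From HB Require Import structures.
Require Import Defs.
From mathcomp Require Import all_boot all_order all_algebra.
From mathcomp Require Import complex finmap.
From mathcomp Require Import all_classical all_reals all_analysis.
From mathcomp Require Import ring lra.
From Stdlib Require Ncring Ncring_tac.

(* The seminorms of the topology tau come from linear functionals, and every
   finite linear combination of matrix tests is, on linear maps, a positive
   multiple of a single matrix test (scale the matrices, put them in diagonal
   blocks and average the states).  Hence a point outside the tau-closure of a
   convex set of completely positive maps is strictly separated from it by one
   matrix test, so that the support function determines the closure; conversely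
   the support function only depends on the closure by continuity.

   Two facts about C*-algebras are needed.  First, the set CP is C*-convex, so
   that cconv K consists of completely positive maps: this amounts to sums of
   elements y^* y of M_k(T) being again of this form.  Second, T has a state
   (otherwise there would be no matrix test to tell the empty set from a
   nonempty one).  Both rest on Kaplansky's theorem that y^* y is positive in
   T, proved without spectral theory from the square root of 1 - W as a limit
   of polynomials in W.  For M_k(T) no C*-norm is used: the Banach algebra norm
   given by the sum of the norms of the entries suffices, because positivity
   bounds the entries of the powers of W. *)

Set Implicit Arguments.
Unset Strict Implicit.
Unset Printing Implicit Defensive.
Import Order.TTheory GRing.Theory Num.Theory.
Import numFieldNormedType.Exports.
Local Open Scope classical_set_scope.
Local Open Scope ring_scope.
Local Open Scope complex_scope.

(** * Square roots in Banach algebras *)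

(** Opens every ring to the tactic [non_commutative_ring], with Leibniz equality. *)
#[local] Instance ncring_ops (B : pzRingType) :
  @Ncring.Ring_ops B 0 1 +%R *%R (fun x y => x - y) -%R eq := {}.
#[local] Instance ncring (B : pzRingType) : Ncring.Ring (T := B).
Proof.
constructor; first (by split=> [x|x y|x y z]; [|exact: esym|exact: etrans]).
1-3: by move=> x _ <- y _ <-.
- by move=> x _ <-.
- exact: add0r.
- exact: addrC.
- exact: addrA.
- exact: mul1r.
- exact: mulr1.
- exact: mulrA.
- exact: mulrDl.
- by move=> x y z; exact: mulrDr.
- by [].
- exact: subrr.
Qed.

Record banach_norm (R : realType) (B : algType R[i]) (N : B -> R) : Prop :=
  BanachNorm {
  bn_eq0 : forall x, N x = 0 -> x = 0;
  bnD : forall x y, N (x + y) <= N x + N y;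
  bnZ : forall (r : R) x, N (r%:C *: x) = `|r| * N x;
  bnM : forall x y, N (x * y) <= N x * N y;
  bn_complete : forall u : nat -> B,
    (forall e : R, 0 < e -> exists n0, forall m n,
       (n0 <= m)%N -> (n0 <= n)%N -> N (u m - u n) < e) ->
    exists l, forall e, 0 < e -> exists n0, forall n, (n0 <= n)%N ->
       N (u n - l) < e }.

Section Poly.
Variables (R : realType) (B : algType R[i]).

Definition rhorner (W : B) (p : {poly R}) : B :=
  horner_alg W (map_poly (real_complex R) p).

Definition nneg_poly (p : {poly R}) := forall i, 0 <= p`_i.

(** The limit is the power series of 1 - sqrt(1 - X): a fixed point x of the recursion satisfies (1
    - x)^2 = 1 - X. *)
Fixpoint sqrt_poly n : {poly R} :=
  if n is m.+1 then 2^-1 *: ('X + sqrt_poly m ^+ 2) else 0.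

Lemma rhornerE W p : rhorner W p = \sum_(i < size p) (p`_i)%:C *: W ^+ i.
Proof.
rewrite /rhorner -{1}[p]coefK poly_def !rmorph_sum /=; apply: eq_bigr => i _.
by rewrite map_polyZ linearZ /= map_polyXn rmorphXn /= horner_algX mulr_algl.
Qed.

Lemma nneg_polyD p q : nneg_poly p -> nneg_poly q -> nneg_poly (p + q).
Proof. by move=> hp hq i; rewrite coefD addr_ge0. Qed.

Lemma nneg_polyM p q : nneg_poly p -> nneg_poly q -> nneg_poly (p * q).
Proof. by move=> hp hq i; rewrite coefM sumr_ge0 // => j _; rewrite mulr_ge0. Qed.

Lemma nneg_polyZ c p : 0 <= c -> nneg_poly p -> nneg_poly (c *: p).
Proof. by move=> hc hp i; rewrite coefZ mulr_ge0. Qed.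

Lemma nneg_polyX : nneg_poly 'X.
Proof. by move=> i; rewrite coefX ler0n. Qed.

Lemma sqrt_poly_nneg n : nneg_poly (sqrt_poly n).
Proof.
elim: n => [i|n IHn]; first by rewrite coef0.
apply: nneg_polyZ; first by rewrite invr_ge0.
by rewrite expr2; apply: nneg_polyD nneg_polyX (nneg_polyM IHn IHn).
Qed.

(** Each further difference is half a difference of squares; of its two factors the first has
    nonnegative coefficients by induction. *)
Lemma sqrt_poly_incrS n : nneg_poly (sqrt_poly n.+1 - sqrt_poly n).
Proof.
elim: n => [|n IHn]; first by rewrite subr0; exact: sqrt_poly_nneg.
have -> : sqrt_poly n.+2 - sqrt_poly n.+1 =
    2^-1 *: ((sqrt_poly n.+1 - sqrt_poly n) * (sqrt_poly n.+1 + sqrt_poly n)).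
  rewrite -subr_sqr [sqrt_poly n.+2]/= [X in _ - X]/= -scalerBr.
  by rewrite opprD addrACA subrr add0r.
apply: nneg_polyZ; first by rewrite invr_ge0.
by apply: nneg_polyM => //; apply: nneg_polyD; exact: sqrt_poly_nneg.
Qed.

Lemma sqrt_poly_incr m n : (m <= n)%N -> nneg_poly (sqrt_poly n - sqrt_poly m).
Proof.
move=> /subnK <-; elim: (n - m)%N => [i|k IHk]; first by rewrite add0n subrr coef0.
have -> : sqrt_poly (k.+1 + m) - sqrt_poly m =
  (sqrt_poly (k + m).+1 - sqrt_poly (k + m)) + (sqrt_poly (k + m) - sqrt_poly m).
  by rewrite addrA subrK.
by apply: nneg_polyD => //; exact: sqrt_poly_incrS.
Qed.

Lemma nneg_poly_horner1 p : nneg_poly p -> 0 <= p.[1].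
Proof.
by move=> hp; rewrite horner_coef sumr_ge0 // => i _; rewrite expr1n mulr1.
Qed.

Lemma sqrt_poly_horner1_le1 n : (sqrt_poly n).[1] <= 1.
Proof.
elim: n => [|n IHn] /=; first by rewrite horner0.
rewrite !hornerE expr2.
have := nneg_poly_horner1 (sqrt_poly_nneg n); nra.
Qed.

Lemma sqrt_poly_horner1_cauchy (e : R) : 0 < e -> exists n0, forall m n,
  (n0 <= m)%N -> (m <= n)%N -> (sqrt_poly n - sqrt_poly m).[1] < e.
Proof.
move=> e0; set a := fun n => (sqrt_poly n).[1].
have hle n : a n <= sup (range a).
  apply: ub_le_sup; last by exists n.
  by exists 1 => _ [k _ <-]; exact: sqrt_poly_horner1_le1.
have [_ [n0 _ <-] h0] : exists2 x, range a x & sup (range a) - e < x.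
  apply: sup_adherent => //; split; first by exists (a 0%N), 0%N.
  by exists 1 => _ [k _ <-]; exact: sqrt_poly_horner1_le1.
exists n0 => m n hm _; rewrite hornerD hornerN.
have := nneg_poly_horner1 (sqrt_poly_incr hm); rewrite hornerD hornerN.
by have := hle n; rewrite /a in h0 *; lra.
Qed.

End Poly.
Arguments sqrt_poly : clear implicits.

Section Banach.
Variables (R : realType) (B : algType R[i]) (N : B -> R).
Hypothesis hN : banach_norm N.

Lemma bn0 : N 0 = 0.
Proof. by have := bnZ hN 0 0; rewrite scaler0 normr0 mul0r. Qed.

Lemma bnN x : N (- x) = N x.
Proof. by have := bnZ hN (-1) x; rewrite rmorphN1 scaleN1r normrN1 mul1r. Qed.

Lemma bnB x y : N (x - y) <= N x + N y.
Proof. by rewrite (le_trans (bnD hN _ _)) // bnN. Qed.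

Lemma bn_distC x y : N (x - y) = N (y - x).
Proof. by rewrite -bnN opprB. Qed.

Lemma bn_ge0 x : 0 <= N x.
Proof. by have := bnB x x; rewrite subrr bn0; lra. Qed.

Lemma bn_sum I (r : seq I) (F : I -> B) :
  N (\sum_(i <- r) F i) <= \sum_(i <- r) N (F i).
Proof.
elim: r => [|i r IHr]; first by rewrite !big_nil bn0.
by rewrite !big_cons (le_trans (bnD hN _ _)) // lerD2l.
Qed.

Lemma bn_eq0_lt x : (forall e, 0 < e -> N x < e) -> x = 0.
Proof.
move=> h; apply: (bn_eq0 hN); apply/eqP; rewrite eq_le bn_ge0 andbT leNgt.
by apply/negP => /[dup] /h; rewrite ltxx.
Qed.

(** A uniform bound [K] on the powers takes the place of [N W <= 1]; this lets the same square root
    work for matrices with the entry-sum norm. *)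
Lemma rhorner_le W (K : R) p : (forall n, N (W ^+ n) <= K) -> nneg_poly p ->
  N (rhorner W p) <= K * p.[1].
Proof.
move=> hK hp; rewrite rhornerE (le_trans (bn_sum _ _)) // horner_coef mulr_sumr.
apply: ler_sum => i _; rewrite (bnZ hN) ger0_norm // expr1n mulr1 mulrC.
by rewrite ler_wpM2r.
Qed.

(** Records that the square root is a limit of real polynomials in [W]; it inherits self-adjointness
    and commutation in this way. *)
Definition rpoly_limit (W X : B) : Prop :=
  forall e, 0 < e -> exists p : {poly R}, N (X - rhorner W p) < e.

(* The iterates of [x |-> (W + x ^ 2) / 2] are polynomials in [W] whose
   coefficients are nonnegative and increase, so their differences are bounded
   by the corresponding differences at [1]. *)
Lemma banach_sqrt W (K : R) : (forall n, N (W ^+ n) <= K) ->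
  exists X, [/\ (1 - X) * (1 - X) = 1 - W, rpoly_limit W X & N X <= K].
Proof.
move=> hK; pose u n := rhorner W (sqrt_poly R n).
have K0 : 0 <= K by apply: le_trans (bn_ge0 _) (hK 0%N).
have uB m n : (m <= n)%N ->
    N (u n - u m) <= K * (sqrt_poly R n - sqrt_poly R m).[1].
  move=> mn; rewrite /u /rhorner -!rmorphB /=.
  by apply: rhorner_le => //; exact: sqrt_poly_incr.
have uK n : N (u n) <= K.
  apply: le_trans (rhorner_le hK (@sqrt_poly_nneg R n)) _.
  by rewrite ler_piMr // sqrt_poly_horner1_le1.
have [X hX] : exists X, forall e, 0 < e -> exists n0, forall n, (n0 <= n)%N ->
    N (u n - X) < e.
  apply: (bn_complete hN) => e e0.
  have K1 : 0 < K + 1 by lra.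
  have [n0 hn0] := sqrt_poly_horner1_cauchy (divr_gt0 e0 K1).
  have {}hn0 : forall m n, (n0 <= m)%N -> (m <= n)%N -> N (u n - u m) < e.
    move=> m n hm mn; apply: le_lt_trans (uB _ _ mn) _.
    have := hn0 _ _ hm mn; rewrite ltr_pdivlMr // => h; apply: le_lt_trans h.
    rewrite mulrC; apply: ler_wpM2l; last lra.
    by apply: nneg_poly_horner1; exact: sqrt_poly_incr.
  exists n0 => m n hm hn; case: (leqP m n) => [mn|/ltnW mn]; last exact: hn0.
  by rewrite bn_distC; exact: hn0.
have NX : N X <= K.
  apply/ler_addgt0Pr => e /hX[n0 /(_ n0 (leqnn _))] h.
  have := bnB (u n0) (u n0 - X); rewrite subKr => /le_trans; apply.
  by rewrite lerD // ltW.
exists X; split=> //; last first.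
  move=> e /hX[n0 /(_ n0 (leqnn _))] h; exists (sqrt_poly R n0).
  by rewrite bn_distC.
suff h : W = X + X - X * X by rewrite h; Ncring_tac.non_commutative_ring.
apply/eqP; rewrite -subr_eq0; apply/eqP; apply: bn_eq0_lt => e e0.
(* With [d] this quotient, the two terms y - X contribute less than 2d and the two products at most
   2Kd. *)
have d0 : 0 < e / (4 + 2 * K + 1) by rewrite divr_gt0 //; lra.
have [n0 hn0] := hX _ d0.
have h0 := hn0 n0 (leqnn _); have h1 := hn0 n0.+1 (leqnSn _).
have hS : W = u n0.+1 + u n0.+1 - u n0 * u n0.
  apply/eqP; rewrite eq_sym subr_eq; apply/eqP.
  rewrite /u /= /rhorner map_polyZ linearZ /= mulr_algl -scalerDl -rmorphD /=.
  have -> : 2^-1 + 2^-1 = 1 :> R by field.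
  rewrite scale1r rmorphD /= rmorphXn /= map_polyX rmorphD rmorphXn /=.
  by rewrite horner_algX expr2.
rewrite {}hS; set x := u n0 in h0 *; set y := u n0.+1 in h1 *.
have -> : y + y - x * x - (X + X - X * X) =
    (y - X) + (y - X) - ((x - X) * X + x * (x - X)).
  by Ncring_tac.non_commutative_ring.
have NxX : N x <= K by exact: uK.
have h2 : N ((x - X) * X) <= N (x - X) * K.
  by apply: le_trans (bnM hN _ _) _; rewrite ler_wpM2l // bn_ge0.
have h3 : N (x * (x - X)) <= K * N (x - X).
  by apply: le_trans (bnM hN _ _) _; rewrite ler_wpM2r // bn_ge0.
have h4 := bnB (y - X + (y - X)) ((x - X) * X + x * (x - X)).
have h5 := bnD hN (y - X) (y - X).
have h6 := bnD hN ((x - X) * X) (x * (x - X)).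
set d := e / _ in h0 h1 d0.
have -> : e = d * (4 + 2 * K + 1) by rewrite /d divfK // gt_eqF //; lra.
by have := bn_ge0 (x - X); nra.
Qed.

(** Boundedness carries the vanishing of [D] to limits. The maps used are [star x - x], its matrix
    version, and the commutator with a fixed element. *)
Lemma rpoly_limit_linear (W X : B) (D : B -> B) (C : R) :
  (forall x y, D (x - y) = D x - D y) -> (forall x, N (D x) <= C * N x) ->
  (forall p, D (rhorner W p) = 0) -> rpoly_limit W X -> D X = 0.
Proof.
move=> DB DC D0 hX; apply: bn_eq0_lt => e e0.
have d0 : 0 < e / (`|C| + 1) by rewrite divr_gt0 //; have := normr_ge0 C; lra.
have [p hp] := hX _ d0.
rewrite -[D X]subr0 -(D0 p) -DB (le_lt_trans (DC _)) //.
set d := e / _ in d0 hp.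
have -> : e = d * (`|C| + 1).
  by rewrite /d divfK // gt_eqF //; have := normr_ge0 C; lra.
have := bn_ge0 (X - rhorner W p); have := ler_norm C; have := normr_ge0 C.
by nra.
Qed.

Lemma comm_rhorner (W Z : B) p : GRing.comm Z W -> GRing.comm Z (rhorner W p).
Proof.
move=> ZW; rewrite rhornerE; apply: commr_sum => i _.
by rewrite /GRing.comm -scalerAr -scalerAl (commrX _ ZW).
Qed.

Lemma comm_rpoly_limit (W X Z : B) :
  rpoly_limit W X -> GRing.comm Z W -> GRing.comm Z X.
Proof.
move=> hX ZW; apply/eqP; rewrite -subr_eq0; apply/eqP.
apply: (@rpoly_limit_linear W X (fun x => Z * x - x * Z) (2 * N Z)) => //.
- by move=> x y /=; Ncring_tac.non_commutative_ring.
- move=> x; have := bnB (Z * x) (x * Z); have := bnM hN Z x; have := bnM hN x Z.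
  by rewrite [N x * _]mulrC; lra.
- by move=> p; rewrite (comm_rhorner _ ZW) subrr.
Qed.

End Banach.

(** * Positive elements of a C*-algebra *)

Lemma normc_real (R : realType) (r : R) : Normc.normc r%:C = `|r|.
Proof. by rewrite /= expr0n addr0 sqrtr_sqr. Qed.

Section CStar.
Variables (R : realType) (T : cstarAlgType R).
Implicit Types x y z h a b c : T.

Lemma cnorm_banach : banach_norm (@cnorm R T).
Proof.
split; [exact: cnorm_eq0|exact: cnormD| |exact: cnormM|].
  by move=> r x; rewrite cnormZ normc_real.
move=> u hu; have [l hl] := @cnorm_complete R T u hu; exists l => e e0.
have /cvgr0Pnorm_lt /(_ e e0) [n0 _ hn0] := hl.
by exists n0 => n hn; exact: le_lt_trans (ler_norm _) (hn0 n hn).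
Qed.
Let hN := cnorm_banach.

Lemma star1 : star (1 : T) = 1.
Proof. by have := starM 1 (star (1 : T)); rewrite mul1r starK mul1r => <-. Qed.

Lemma star_real (r : R) x : star (r%:C *: x) = r%:C *: star x.
Proof. by rewrite starZ conjc_real. Qed.

Lemma starN x : star (- x) = - star x.
Proof. by have := star_real (-1) x; rewrite rmorphN1 !scaleN1r. Qed.

Lemma starB x y : star (x - y) = star x - star y.
Proof. by rewrite starD starN. Qed.

Lemma star0 : star (0 : T) = 0.
Proof. by have := starB 0 0; rewrite !subrr. Qed.

Lemma star_sum I (r : seq I) (F : I -> T) :
  star (\sum_(i <- r) F i) = \sum_(i <- r) star (F i).
Proof. exact: (big_morph _ starD star0). Qed.

Lemma starX h n : star h = h -> star (h ^+ n) = h ^+ n.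
Proof.
move=> hs; elim: n => [|n IHn]; first exact: star1.
by rewrite exprS starM IHn hs -exprS -exprSr.
Qed.

(** The C*-identity gives |y|^2 <= |y^*| |y|; cancel |y| and exchange y with y^*. *)
Lemma cnorm_starE x : cnorm (star x) = cnorm x.
Proof.
suff le y : cnorm y <= cnorm (star y).
  by apply/eqP; rewrite eq_le le -{2}[x]starK le.
have [->|y0] := eqVneq (cnorm y) 0; first exact: (bn_ge0 hN).
have {}y0 : 0 < cnorm y by rewrite lt_def y0 (bn_ge0 hN).
by rewrite -(ler_pM2r y0) -expr2 -cnorm_star cnormM.
Qed.

Lemma cnorm1 : cnorm (1 : T) = 1.
Proof.
have := cnorm_star (1 : T); rewrite star1 mulr1 expr2 => /eqP.
rewrite -subr_eq0 -{1}[cnorm 1]mul1r -mulrBl mulf_eq0 => /orP[|/eqP/cnorm_eq0/eqP].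
  by rewrite subr_eq0 => /eqP.
by rewrite oner_eq0.
Qed.

Lemma cnorm_sa_sqr h : star h = h -> cnorm (h * h) = cnorm h ^+ 2.
Proof. by move=> hs; rewrite -cnorm_star hs. Qed.

Lemma cnorm_sa_pow2 h m : star h = h -> cnorm (h ^+ (2 ^ m)) = cnorm h ^+ (2 ^ m).
Proof.
move=> hs; elim: m => [|m IHm]; first by rewrite !expr1.
by rewrite expnSr !exprM [_ ^+ 2]expr2 cnorm_sa_sqr ?starX // IHm.
Qed.

Lemma cnorm_pow_le1 h n : cnorm h <= 1 -> cnorm (h ^+ n) <= 1.
Proof.
move=> h1; elim: n => [|n IHn]; first by rewrite cnorm1.
rewrite exprS (le_trans (cnormM _ _)) // -[leRHS]mulr1.
by rewrite ler_pM ?(bn_ge0 hN).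
Qed.

(** [banach_sqrt] applies to 1 - h, whose powers have norm at most 1; the root is 1 - X with X a
    limit of polynomials in 1 - h. *)
Lemma cstar_sqrt h : star h = h -> cnorm (1 - h) <= 1 ->
  exists b, [/\ star b = b, b * b = h, cnorm (1 - b) <= 1
    & forall z, GRing.comm z h -> GRing.comm z b].
Proof.
move=> hs h1; have := @banach_sqrt R T _ hN (1 - h) 1.
case=> [n|X [XX Xlim X1]]; first exact: cnorm_pow_le1.
exists (1 - X); split.
- rewrite starB star1; congr (_ - _); apply/eqP; rewrite -subr_eq0; apply/eqP.
  apply: (@rpoly_limit_linear R T _ hN (1 - h) X (fun x => star x - x) 2) => //.
  + by move=> x y; rewrite starB; Ncring_tac.non_commutative_ring.
  + by move=> x; have := bnB hN (star x) x; rewrite cnorm_starE; lra.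
  + move=> p; rewrite rhornerE star_sum -sumrB big1 // => i _.
    by rewrite star_real starX ?subrr // starB star1 hs.
- by rewrite XX subKr.
- by rewrite subKr.
- move=> z zh; apply: commrB; first exact: commr1.
  by apply: (comm_rpoly_limit hN Xlim); apply: commrB => //; exact: commr1.
Qed.

Lemma sqr_sa_eq0 h : star h = h -> h * h = 0 -> h = 0.
Proof.
move=> hs hh; apply: cnorm_eq0; apply/eqP.
by rewrite -sqrf_eq0 -cnorm_sa_sqr // hh (bn0 hN).
Qed.

Lemma star_imaginary_unit : exists j : T,
  [/\ forall x, j * x = x * j, j * j = -1 & star j = - j].
Proof.
exists ('i *: 1); split.
- by move=> x; rewrite -scalerAl -scalerAr mul1r mulr1.
- by rewrite -scalerAl mul1r scalerA -expr2 sqr_i scaleN1r.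
- rewrite starZ star1 -scaleNr; congr (_ *: _).
  by apply/eqP; rewrite eq_complex /= oppr0 !eqxx.
Qed.

(* [b] is the real part of the normal element [b + i d]. *)
Lemma cnorm_le_sum_sqr b d : star b = b -> star d = d -> GRing.comm b d ->
  cnorm b ^+ 2 <= cnorm (b * b + d * d).
Proof.
move=> bs ds bd; have [j [jC jj js]] := star_imaginary_unit.
have us : star (b + j * d) = b - j * d.
  by rewrite starD starM bs ds js mulrN -jC.
have -> : b * b + d * d = star (b + j * d) * (b + j * d).
  rewrite us mulrDr !mulrBl [b * (j * d)]mulrA -[b * j]jC -!mulrA bd.
  rewrite [d * (j * d)]mulrA -[d * j]jC [j * (j * d * d)]mulrA.
  rewrite [j * (j * d)]mulrA jj mulN1r.
  by Ncring_tac.non_commutative_ring.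
rewrite cnorm_star ler_sqr ?nnegrE ?(bn_ge0 hN) //.
have := cnormD (b + j * d) (star (b + j * d)); rewrite cnorm_starE us.
have -> : b + j * d + (b - j * d) = 2%:R%:C *: b.
  by rewrite addrACA subrr addr0 -mulr2n -scaler_nat rmorph_nat.
by rewrite (bnZ hN) ger0_norm //; lra.
Qed.

(** Let k be the square root of 1 - h^2; it commutes with h, so |k|^2 <= |k^2 + h^2| = 1. *)
Lemma cnorm_1_sub_sqr h : star h = h -> cnorm h <= 1 -> cnorm (1 - h * h) <= 1.
Proof.
move=> hs h1.
have [||k [ks kk _ kC]] := @cstar_sqrt (1 - h * h).
- by rewrite starB star1 starM hs.
- by rewrite subKr (le_trans (cnormM _ _)) // -[leRHS]mulr1 ler_pM ?(bn_ge0 hN).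
rewrite -kk cnorm_sa_sqr //.
have -> : 1 = cnorm (k * k + h * h) by rewrite kk subrK cnorm1.
apply: cnorm_le_sum_sqr => //.
by apply/commr_sym/kC; apply: commrB; [exact: commr1|exact: commrM].
Qed.

(** Positivity without spectra: for self-adjoint x the inequality says that the spectrum lies in
    [0, 2t]. Sums then follow from the triangle inequality. *)
Definition posC x : Prop :=
  star x = x /\ exists2 t : R, 0 <= t & cnorm (t%:C *: 1 - x) <= t.

Lemma posCD x y : posC x -> posC y -> posC (x + y).
Proof.
move=> [xs [t t0 xt]] [ys [r r0 yr]]; split; first by rewrite starD xs ys.
exists (t + r); first exact: addr_ge0.
rewrite rmorphD scalerDl opprD addrACA (le_trans (cnormD _ _)) //.
exact: lerD.
Qed.

Lemma posCZ (r : R) x : 0 <= r -> posC x -> posC (r%:C *: x).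
Proof.
move=> r0 [xs [t t0 xt]]; split; first by rewrite star_real xs.
exists (r * t); first exact: mulr_ge0.
by rewrite rmorphM -scalerA -scalerBr (bnZ hN) ger0_norm // ler_wpM2l.
Qed.

Lemma posC0 : posC 0.
Proof. by split; [exact: star0|exists 0 => //; rewrite subr0 scale0r (bn0 hN)]. Qed.

Lemma posC_sum I (r : seq I) (F : I -> T) :
  (forall i, posC (F i)) -> posC (\sum_(i <- r) F i).
Proof. by move=> hF; elim/big_ind: _ => // [|x y]; [exact: posC0|exact: posCD]. Qed.

Lemma posC_order_unit x (t : R) : star x = x -> cnorm x <= t ->
  posC (t%:C *: 1 - x).
Proof.
move=> xs xt; split; first by rewrite starB star_real star1 xs.
by exists t; [exact: le_trans (bn_ge0 hN x) xt|rewrite subKr].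
Qed.

Lemma posC_sqr h : star h = h -> posC (h * h).
Proof.
move=> hs; split; first by rewrite starM hs.
have r0 : 0 < cnorm h + 1 by have := bn_ge0 hN h; lra.
set r := cnorm h + 1 in r0.
exists (r * r); first by rewrite mulr_ge0 // ltW.
have := @cnorm_1_sub_sqr ((r^-1)%:C *: h).
rewrite star_real hs (bnZ hN) ger0_norm ?invr_ge0 ?(ltW r0) // => /(_ erefl).
have le : r^-1 * cnorm h <= 1 by rewrite mulrC ler_pdivrMr // mul1r /r; lra.
move=> /(_ le) h1.
have -> : (r * r)%:C *: 1 - h * h =
    (r * r)%:C *: (1 - (r^-1)%:C *: h * ((r^-1)%:C *: h)) :> T.
  rewrite scalerBr -scalerAl -scalerAr !scalerA -!rmorphM /=.
  by rewrite mulfK ?gt_eqF // mulfV ?gt_eqF // scale1r.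
rewrite (bnZ hN) ger0_norm ?mulr_ge0 // ?(ltW r0) //.
by rewrite ler_piMr // mulr_ge0 // ltW.
Qed.

Lemma posC_has_sqrt x : posC x -> exists b, [/\ star b = b, b * b = x
    & forall z, GRing.comm z x -> GRing.comm z b].
Proof.
move=> [xs [t]]; rewrite le_eqVlt => /predU1P[<-|t0] xt.
  exists 0; rewrite star0 mulr0; split=> //; last by move=> z _; exact: commr0.
  move: xt; rewrite scale0r sub0r (bnN hN) => xt.
  by apply/esym/cnorm_eq0/eqP; rewrite eq_le xt (bn_ge0 hN).
have [||b [bs bb _ bC]] := @cstar_sqrt ((t^-1)%:C *: x).
- by rewrite star_real xs.
- have -> : 1 - (t^-1)%:C *: x = (t^-1)%:C *: (t%:C *: 1 - x).
    by rewrite scalerBr scalerA -rmorphM mulVf ?gt_eqF // scale1r.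
  rewrite (bnZ hN) ger0_norm ?invr_ge0 ?(ltW t0) //.
  by rewrite mulrC ler_pdivrMr // mul1r.
exists ((Num.sqrt t)%:C *: b); split.
- by rewrite star_real bs.
- rewrite -scalerAl -scalerAr scalerA -rmorphM -expr2 sqr_sqrtr ?(ltW t0) //.
  by rewrite bb scalerA -rmorphM mulfV ?gt_eqF // scale1r.
- move=> z zx; rewrite /GRing.comm -scalerAl -scalerAr bC //.
  by rewrite /GRing.comm -scalerAl -scalerAr zx.
Qed.

(** The square roots b of x and d of 1 - x commute, so |b|^2 <= |b^2 + d^2| = 1. *)
Lemma posC_normal x : posC x -> posC (1 - x) -> cnorm x <= 1.
Proof.
move=> px p1x; have [b [bs bb bC]] := posC_has_sqrt px.
have [d [ds dd dC]] := posC_has_sqrt p1x.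
rewrite -bb cnorm_sa_sqr //.
have -> : 1 = cnorm (b * b + d * d) by rewrite bb dd addrC subrK cnorm1.
apply: cnorm_le_sum_sqr => //.
apply: dC; apply: commrB; first exact: commr1.
by rewrite -bb; exact: commrM.
Qed.

Lemma posC_antisym x : posC x -> posC (- x) -> x = 0.
Proof.
move=> px pnx; have [b [bs bb bC]] := posC_has_sqrt px.
have [d [ds dd dC]] := posC_has_sqrt pnx.
have bd : GRing.comm b d by apply: dC; rewrite -bb; exact/commrN/commrM.
have := cnorm_le_sum_sqr bs ds bd.
rewrite -cnorm_sa_sqr // bb dd subrr (bn0 hN) => xl.
by apply/cnorm_eq0/eqP; rewrite eq_le xl (bn_ge0 hN).
Qed.

(** Twice this element is p^2 + q^2 with the self-adjoint p = y + y^* and q = i y - i y^*. *)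
Lemma posC_sum_sqr_swap y : posC (star y * y + y * star y).
Proof.
have [j [jC jj js]] := star_imaginary_unit.
pose p := y + star y; pose q := j * (y - star y).
have ps : star p = p by rewrite /p starD starK addrC.
have qs : star q = q.
  by rewrite /q starM js starB starK mulrN -jC -mulrN opprB.
have -> : star y * y + y * star y = (2^-1)%:C *: (p * p + q * q).
  have -> : p * p + q * q = 2%:R%:C *: (star y * y + y * star y).
    rewrite rmorph_nat scaler_nat mulr2n /q -mulrA [_ * (j * _)]mulrA -jC -mulrA.
    rewrite [j * (j * _)]mulrA jj mulN1r /p.
    by Ncring_tac.non_commutative_ring.
  by rewrite scalerA -rmorphM mulVf ?scale1r.
by apply: posCZ; [rewrite invr_ge0|apply: posCD; exact: posC_sqr].
Qed.

(** If a = 1 + d with d > 0 and N = 2^m, squaring Bernoulli's inequality gives (1 + N d)^2 <= 1 + 2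
    N M, so N d^2 <= 2 M for all m, which is absurd. *)
Lemma le1_of_pow2_le (a M : R) : 0 <= a ->
  (forall m, a ^+ (2 ^ m) <= 1 + (2 ^ m)%:R * M) -> a <= 1.
Proof.
move=> a0 h; rewrite leNgt; apply/negP => a1.
have [d d0 ad] : exists2 d, 0 < d & a = 1 + d.
  by exists (a - 1); [rewrite subr_gt0|rewrite addrC subrK].
have bern n : 1 + n%:R * d <= a ^+ n.
  elim: n => [|n IHn]; first by rewrite mul0r addr0.
  rewrite exprS -nat1r; apply: (@le_trans _ _ (a * (1 + n%:R * d))).
    have : 0 <= n%:R * (d * d) by rewrite !mulr_ge0 // ltW.
    by rewrite ad; lra.
  by rewrite ler_wpM2l.
have key m : (2 ^ m)%:R * (d * d) <= 2 * M.
  have := h m.+1; rewrite expnS mulnC exprM natrM.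
  have := bern (2 ^ m)%N; have N1 : 1 <= (2 ^ m)%:R :> R by rewrite ler1n expn_gt0.
  move: (_%:R) N1 (a ^+ _) => N N1 A b1 b2.
  have Nd : 0 <= N * d by rewrite mulr_ge0 ?(ltW d0) // (le_trans ler01).
  have b3 : (1 + N * d) * (1 + N * d) <= A ^+ 2 by rewrite expr2 ler_pM ?addr_ge0.
  have b4 : N * (N * (d * d)) <= N * (2 * M) by lra.
  by rewrite ler_pM2l in b4 => //; lra.
have dd : 0 < d * d by exact: mulr_gt0.
have := key (Num.truncn (2 * M / (d * d))).+1.
rewrite leNgt -ltr_pdivrMr // => /negP; apply.
apply: lt_trans (truncnS_gt _) _.
by rewrite ltr_nat ltn_expl.
Qed.

(* With [q = - z z^*], one has [(1 - q) ^ n = 1 + z g z^*] where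
   [g = sum_(j < n) (1 - c ^ 2) ^ j] has norm at most [n]; so the norms of the
   powers of [1 - q] grow at most linearly, which forces [norm (1 - q) <= 1]. *)
Lemma posC_flip_contraction z c : star c = c -> cnorm c <= 1 ->
  star z * z = - (c * c) -> posC (- (z * star z)).
Proof.
move=> cs c1 zz; set w := z * star z.
have ws : star w = w by rewrite starM starK.
split; first by rewrite starN ws.
exists 1 => //; rewrite scale1r opprK.
have pw n : (1 + w) ^+ n =
    1 + z * (\sum_(j < n) (1 - c * c) ^+ j) * star z.
  elim: n => [|n IHn]; first by rewrite big_ord0 mulr0 mul0r addr0.
  rewrite exprS IHn big_ord_recl expr0.
  set s := \sum_(j < n) _.
  have -> : \sum_(j < n) (1 - c * c) ^+ lift ord0 j = (1 - c * c) * s.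
    by rewrite mulr_sumr; apply: eq_bigr => j _; rewrite -exprS.
  have -> : (1 - c * c) * s = s + star z * z * s.
    by rewrite zz; Ncring_tac.non_commutative_ring.
  by rewrite /w; Ncring_tac.non_commutative_ring.
apply: (@le1_of_pow2_le _ (cnorm z * cnorm z)); first exact: bn_ge0.
move=> m; rewrite -cnorm_sa_pow2 ?starD ?star1 ?ws // pw.
rewrite (le_trans (cnormD _ _)) // cnorm1 lerD2l.
rewrite (le_trans (cnormM _ _)) // cnorm_starE mulrA.
rewrite ler_wpM2r ?(bn_ge0 hN) // (le_trans (cnormM _ _)) // mulrC.
rewrite ler_wpM2r ?(bn_ge0 hN) // (le_trans (bn_sum hN _ _)) //.
apply: (@le_trans _ _ (\sum_(j < 2 ^ m) 1)).
  by apply: ler_sum => j _; apply/cnorm_pow_le1/cnorm_1_sub_sqr.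
by rewrite sumr_const card_ord.
Qed.

(** Stands in for the equality of the nonzero spectra of z^* z and z z^*; scaling reduces to a
    contraction [c]. *)
Lemma posC_flip z c : star c = c -> star z * z = - (c * c) ->
  posC (- (z * star z)).
Proof.
move=> cs zz; pose r := cnorm c + 1.
have r0 : 0 < r by rewrite /r; have := bn_ge0 hN c; lra.
have ri0 : 0 <= r^-1 by rewrite invr_ge0 ltW.
have := @posC_flip_contraction ((r^-1)%:C *: z) ((r^-1)%:C *: c).
rewrite !star_real cs (bnZ hN) ger0_norm // => /(_ erefl).
have le : r^-1 * cnorm c <= 1 by rewrite mulrC ler_pdivrMr // mul1r /r; lra.
move=> /(_ le); rewrite -!scalerAl -!scalerAr zz !scalerN => /(_ erefl) h.
have := posCZ (mulr_ge0 (ltW r0) (ltW r0)) h.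
rewrite scalerN !scalerA -!rmorphM /=.
by rewrite mulfK ?gt_eqF // mulfV ?gt_eqF // scale1r.
Qed.

(* With [h = y^* y], [a = |h|], [m = a - h] (twice the negative part of [h])
   and [z = y m], one has [z^* z = m h m = - a m ^ 2], which is minus a square;
   flipping makes [z^* z] both positive and negative, hence [m = 0]. *)
Lemma posC_star_mul y : posC (star y * y).
Proof.
wlog y1 : y / cnorm y <= 1.
  move=> hw; pose r := cnorm y + 1.
  have r0 : 0 < r by rewrite /r; have := bn_ge0 hN y; lra.
  have ri0 : 0 <= r^-1 by rewrite invr_ge0 ltW.
  have := hw ((r^-1)%:C *: y); rewrite (bnZ hN) ger0_norm //.
  have le : r^-1 * cnorm y <= 1 by rewrite mulrC ler_pdivrMr // mul1r /r; lra.
  move=> /(_ le); rewrite star_real -scalerAl -scalerAr => h.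
  have := posCZ (mulr_ge0 (ltW r0) (ltW r0)) h.
  rewrite !scalerA -!rmorphM /=.
  by rewrite mulfK ?gt_eqF // mulfV ?gt_eqF // scale1r.
set h := star y * y.
have hs : star h = h by rewrite starM starK.
have h1 : cnorm h <= 1 by rewrite cnorm_star expr_le1 ?(bn_ge0 hN).
have [||a [as_ aa a1 aC]] := @cstar_sqrt (h * h).
- by rewrite starM hs.
- exact: cnorm_1_sub_sqr.
(* [b] is the square root of |h|; it turns a m^2 into the square of the self-adjoint b m. *)
have [b [bs bb _ bC]] := cstar_sqrt as_ a1.
have ha : GRing.comm h a by apply: aC; exact: commrM.
have hb : GRing.comm h b by exact: bC.
have ab : GRing.comm a b by exact: bC.
pose m := a - h.
have ms : star m = m by rewrite /m starB as_ hs.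
have bm : GRing.comm b m by apply: commrB; exact: commr_sym.
have am : GRing.comm a m by apply: commrB => //; exact: commr_sym.
have mh : m * h = - (a * m).
  by rewrite /m mulrBl mulrBr -aa -ha opprB.
have zz : star (y * m) * (y * m) = - ((b * m) * (b * m)).
  rewrite starM ms -!mulrA [star y * _]mulrA -/h [m * (h * m)]mulrA mh mulNr.
  by rewrite -bb -!mulrA; congr (- (b * _)); rewrite !mulrA bm.
have cs : star (b * m) = b * m by rewrite starM ms bs bm.
have p1 : posC (- ((b * m) * (b * m))).
  rewrite -zz; have := posCD (posC_sum_sqr_swap (y * m)) (posC_flip cs zz).
  by rewrite addrK.
have c0 : b * m * (b * m) = 0 by apply: posC_antisym => //; exact: posC_sqr.
have am0 : a * m * m = 0.
  by rewrite -c0 -bb -!mulrA; congr (b * _); rewrite !mulrA bm.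
have mm : m * m = 2%:R%:C *: (a * m).
  have hm : h * m = - (a * m) by rewrite -mh /m mulrBl mulrBr ha.
  by rewrite rmorph_nat scaler_nat mulr2n {1}/m mulrBl hm opprK.
(* From m^2 = 2 a m follows m^3 = 2 a m^2 = 0, so m^4 = 0; self-adjointness then removes the squares
   twice. *)
have m0 : m = 0.
  apply: sqr_sa_eq0 => //; apply: sqr_sa_eq0; first by rewrite starM ms.
  by rewrite mulrA {1}mm -scalerAl am0 scaler0 mul0r.
have -> : h = b * b by rewrite bb; apply/eqP; rewrite eq_sym -subr_eq0 -/m m0.
exact: posC_sqr.
Qed.

End CStar.

(** * Positivity in matrix algebras *)

Section MatrixStar.
Variables (R : realType) (T : cstarAlgType R).

Lemma mx_starM m n p (M : 'M[T]_(m, n)) (N : 'M[T]_(n, p)) :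
  mx_star (M *m N) = mx_star N *m mx_star M.
Proof.
apply/matrixP => i j; rewrite !mxE star_sum; apply: eq_bigr => k _.
by rewrite !mxE starM.
Qed.

Lemma mx_starK m n (M : 'M[T]_(m, n)) : mx_star (mx_star M) = M.
Proof. by apply/matrixP => i j; rewrite !mxE starK. Qed.

Lemma mx_starD m n (M N : 'M[T]_(m, n)) : mx_star (M + N) = mx_star M + mx_star N.
Proof. by apply/matrixP => i j; rewrite !mxE starD. Qed.

Lemma mx_starN m n (M : 'M[T]_(m, n)) : mx_star (- M) = - mx_star M.
Proof. by apply/matrixP => i j; rewrite !mxE starN. Qed.

Lemma mx_starB m n (M N : 'M[T]_(m, n)) : mx_star (M - N) = mx_star M - mx_star N.
Proof. by rewrite mx_starD mx_starN. Qed.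

Lemma mx_star0 m n : mx_star (0 : 'M[T]_(m, n)) = 0.
Proof. by apply/matrixP => i j; rewrite !mxE star0. Qed.

Lemma mx_star1 n : mx_star (1%:M : 'M[T]_n) = 1%:M.
Proof.
apply/matrixP => i j; rewrite !mxE eq_sym.
by case: eqP => _; rewrite ?mulr1n ?mulr0n ?star1 ?star0.
Qed.

Lemma mx_star_sum m n I (r : seq I) (F : I -> 'M[T]_(m, n)) :
  mx_star (\sum_(i <- r) F i) = \sum_(i <- r) mx_star (F i).
Proof. exact: (big_morph _ (@mx_starD m n) (@mx_star0 m n)). Qed.

End MatrixStar.

(* The library scales matrices over [T] by [T], which does not make them an
   algebra; here they are made an algebra over the scalars of [T]. *)
Definition mxalg (R : realType) (T : cstarAlgType R) (k : nat) := 'M[T]_k.+1.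

(** * Matrices over a C*-algebra as a Banach algebra, and sums of squares *)

Section MatrixAlgebra.
Variables (R : realType) (T : cstarAlgType R) (k : nat).
Local Notation B := (mxalg T k).

HB.instance Definition _ := GRing.NzRing.copy B 'M[T]_k.+1.

Definition mxalg_scale (c : R[i]) (M : B) : B := map_mx ( *:%R c) M.

Lemma mxalg_scaleA a b M :
  mxalg_scale a (mxalg_scale b M) = mxalg_scale (a * b) M.
Proof. by apply/matrixP => i j; rewrite !mxE scalerA. Qed.

Lemma mxalg_scale1 : left_id 1 mxalg_scale.
Proof. by move=> M; apply/matrixP => i j; rewrite !mxE scale1r. Qed.

Lemma mxalg_scaleDr : right_distributive mxalg_scale +%R.
Proof. by move=> c M N; apply/matrixP => i j; rewrite !mxE scalerDr. Qed.

Lemma mxalg_scaleDl M : {morph mxalg_scale^~ M : a b / a + b}.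
Proof. by move=> a b; apply/matrixP => i j; rewrite !mxE scalerDl. Qed.

HB.instance Definition _ := GRing.Zmodule_isLmodule.Build R[i] B
  mxalg_scaleA mxalg_scale1 mxalg_scaleDr mxalg_scaleDl.

Lemma mxalg_scaleAl (c : R[i]) (M N : B) : c *: (M * N) = c *: M * N.
Proof.
apply/matrixP => i j; rewrite !mxE scaler_sumr; apply: eq_bigr => l _.
by rewrite !mxE scalerAl.
Qed.

HB.instance Definition _ := GRing.Lmodule_isLalgebra.Build R[i] B mxalg_scaleAl.

Lemma mxalg_scaleAr (c : R[i]) (M N : B) : c *: (M * N) = M * (c *: N).
Proof.
apply/matrixP => i j; rewrite !mxE scaler_sumr; apply: eq_bigr => l _.
by rewrite !mxE scalerAr.
Qed.

HB.instance Definition _ := GRing.Lalgebra_isAlgebra.Build R[i] B mxalg_scaleAr.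

Definition mxnorm (M : B) : R := \sum_i \sum_j cnorm (M i j).

Let hN := cnorm_banach T.

Lemma cnorm_le_mxnorm (M : B) i j : cnorm (M i j) <= mxnorm M.
Proof.
have h l : 0 <= \sum_j cnorm (M l j) by apply: sumr_ge0 => *; exact: bn_ge0.
rewrite /mxnorm (bigD1 i) //= (bigD1 j) //= ler_wpDr ?sumr_ge0 // ler_wpDr //.
by apply: sumr_ge0 => *; exact: bn_ge0.
Qed.

Lemma mxnorm_lt (e : R) : 0 < e -> exists2 d, 0 < d &
  forall M : B, (forall i j, cnorm (M i j) < d) -> mxnorm M < e.
Proof.
move=> e0; pose c : R := (k.+1 * k.+1)%:R.
have c0 : 0 < c by rewrite ltr0n.
exists (e / (c + 1)); first by rewrite divr_gt0 //; lra.
move=> M hM; apply: (@le_lt_trans _ _ (c * (e / (c + 1)))).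
  rewrite (_ : c * _ = \sum_(i < k.+1) \sum_(j < k.+1) (e / (c + 1))).
    by apply: ler_sum => i _; apply: ler_sum => j _; exact: ltW.
  by rewrite !sumr_const !card_ord -mulrnA mulr_natl.
by rewrite mulrCA gtr_pMr // ltr_pdivrMr ?mul1r; lra.
Qed.

Lemma mxnorm_banach : banach_norm mxnorm.
Proof.
split.
- move=> M M0; apply/matrixP => i j; rewrite mxE; apply: cnorm_eq0.
  by apply/eqP; rewrite eq_le (bn_ge0 hN) -M0 cnorm_le_mxnorm.
- move=> M N; rewrite -big_split; apply: ler_sum => i _.
  by rewrite -big_split; apply: ler_sum => j _; rewrite mxE cnormD.
- move=> r M; rewrite mulr_sumr; apply: eq_bigr => i _.
  by rewrite mulr_sumr; apply: eq_bigr => j _; rewrite mxE (bnZ hN).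
- move=> M N; rewrite /mxnorm mulr_suml; apply: ler_sum => i _.
  apply: (@le_trans _ _ (\sum_j \sum_l cnorm (M i l) * cnorm (N l j))).
    apply: ler_sum => j _; rewrite mxE (le_trans (bn_sum hN _ _)) //.
    by apply: ler_sum => l _; exact: cnormM.
  rewrite exchange_big mulr_suml /=; apply: ler_sum => l _.
  rewrite -mulr_sumr ler_wpM2l ?(bn_ge0 hN) // [leRHS](bigD1 l) //=.
  rewrite lerDl sumr_ge0 //.
  by move=> *; apply: sumr_ge0 => *; exact: bn_ge0.
- move=> u hu.
  have /choice[l hl] : forall ij : 'I_k.+1 * 'I_k.+1, exists l,
      forall e, 0 < e -> exists n0, forall n, (n0 <= n)%N ->
        cnorm (u n ij.1 ij.2 - l) < e.
    move=> [i j]; apply: (bn_complete hN) => e /hu[n0 hn0]; exists n0 => m n hm hn.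
    apply: le_lt_trans (hn0 m n hm hn).
    by have := cnorm_le_mxnorm (u m - u n) i j; rewrite !mxE.
  exists (\matrix_(i, j) l (i, j)) => e /mxnorm_lt[d d0 hd].
  have /choice[n0 hn0] := fun ij => hl ij d d0.
  exists (\max_ij n0 ij)%N => n hn; apply: hd => i j; rewrite !mxE.
  by apply: (hn0 (i, j)); apply: leq_trans hn; exact: leq_bigmax.
Qed.
Let hB := mxnorm_banach.

Lemma mxnorm_star (M : B) : mxnorm (mx_star M) = mxnorm M.
Proof.
rewrite /mxnorm exchange_big; apply: eq_bigr => i _; apply: eq_bigr => j _.
by rewrite !mxE cnorm_starE.
Qed.

Lemma mx_starX (M : B) n : mx_star M = M -> mx_star (M ^+ n) = M ^+ n.
Proof.
move=> Ms; elim: n => [|n IHn]; first exact: mx_star1.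
by rewrite exprS mx_starM IHn Ms -exprS exprSr.
Qed.

Lemma mx_star_real (r : R) (M : B) :
  mx_star (r%:C *: M : B) = r%:C *: (mx_star M : B).
Proof. by apply/matrixP => i j; rewrite !mxE star_real. Qed.

Lemma mx_sqrt (W : B) (K : R) : mx_star W = W ->
  (forall n, mxnorm (W ^+ n) <= K) ->
  exists2 X : B, mx_star X = X & X * X = 1 - W.
Proof.
move=> Ws hK; have [X [XX Xlim _]] := banach_sqrt hB hK.
exists (1 - X) => //; rewrite mx_starB mx_star1; congr (_ - _).
apply/eqP; rewrite -subr_eq0; apply/eqP.
apply: (@rpoly_limit_linear R B _ hB W X (fun x => mx_star x - x) 2) => //.
- by move=> x y; rewrite mx_starB !opprB addrACA [RHS]addrACA [- x + _]addrC.
- by move=> x; have := bnB hB (mx_star x) x; rewrite mxnorm_star; lra.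
- move=> p; rewrite rhornerE mx_star_sum -sumrB big1 // => i _.
  by rewrite mx_star_real mx_starX ?subrr.
Qed.

(** Closed under sums by construction; that one summand suffices is the content of
    [mx_positive_sos]. *)
Definition sos (M : B) : Prop :=
  exists s : seq B, M = \sum_(Y <- s) mx_star Y * Y.

Lemma sosD M N : sos M -> sos N -> sos (M + N).
Proof. by move=> [s ->] [t ->]; exists (s ++ t); rewrite big_cat. Qed.

Lemma sos_sqr (M : B) : sos (mx_star M * M).
Proof. by exists [:: M]; rewrite big_seq1. Qed.

Lemma sos_conj (V M : B) : sos M -> sos (mx_star V * M * V).
Proof.
move=> [s ->]; exists [seq Y * V | Y <- s]; rewrite big_map mulr_sumr mulr_suml.
by apply: eq_bigr => Y _; rewrite mx_starM !mulrA.
Qed.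

(** 1 - W^n telescopes into differences W^m - W^(m+1), each of which is 1 - W or W (1 - W), by the
    parity of m, conjugated by a power of W. *)
Lemma sos_contraction_pow (W : B) n : mx_star W = W -> sos W -> sos (1 - W) ->
  sos (1 - W ^+ n).
Proof.
move=> Ws pW p1W.
have WsX m := mx_starX m Ws.
have p2 : sos (W * (1 - W)).
  have -> : W * (1 - W) = W * (1 - W) * W + (1 - W) * W * (1 - W).
    by Ncring_tac.non_commutative_ring.
  apply: sosD; first by have := sos_conj W p1W; rewrite Ws.
  by have := sos_conj (1 - W) pW; rewrite mx_starB mx_star1 Ws.
have pS m : sos (W ^+ m - W ^+ m.+1).
  have -> : W ^+ m - W ^+ m.+1 = W ^+ m./2 * (W ^+ odd m * (1 - W)) * W ^+ m./2.
    have cW : GRing.comm (1 - W) (W ^+ m./2).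
      by apply/commr_sym/commrB; [exact: commr1|apply/commr_sym/commrX].
    rewrite -!mulrA cW !mulrA -exprD -exprD addnAC addnn addnC odd_double_half.
    by rewrite mulrBr mulr1 exprSr.
  rewrite -{1}WsX; apply: sos_conj.
  by case: (odd m); rewrite ?expr1 ?mul1r.
elim: n => [|n IHn]; first by rewrite subrr; exists [::]; rewrite big_nil.
by have := sosD IHn (pS n); rewrite addrA subrK.
Qed.

Lemma sos_diag (M : B) i : sos M -> posC (M i i).
Proof.
move=> [s ->]; rewrite summxE; apply: posC_sum => Y.
by rewrite mxE; apply: posC_sum => j; rewrite !mxE; exact: posC_star_mul.
Qed.

(** The diagonal entry j is 1 minus the squares of column j, each positive by Kaplansky's theorem;
    adding back all but one gives |M i j|^2 <= 1. *)
Lemma cnorm_entry_le1 (M : B) i j :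
  sos (1 - mx_star M * M) -> cnorm (M i j) <= 1.
Proof.
move=> /(sos_diag j).
rewrite !mxE eqxx (bigD1 i) //= !mxE opprD addrA => h.
suff : cnorm (star (M i j) * M i j) <= 1.
  by rewrite cnorm_star expr_le1 ?(bn_ge0 hN).
apply: posC_normal; first exact: posC_star_mul.
have := posCD h; rewrite -/(index_enum _); set s := \sum_(_ <- _ | _) _.
move=> /(_ s); rewrite subrK; apply; rewrite /s.
rewrite -big_filter; apply: posC_sum => l.
by rewrite !mxE; exact: posC_star_mul.
Qed.

(* Scale the sum to [H <= 1].  In the order given by sums of squares the powers
   of [1 - H] lie between [0] and [1], so their entries are contractions, and
   [H = 1 - (1 - H)] has a square root. *)
Lemma mx_positive_sos (H : B) : sos H -> exists Z : B, H = mx_star Z * Z.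
Proof.
move=> pH; have Hs : mx_star H = H.
  case: pH => s ->; rewrite mx_star_sum; apply: eq_bigr => Y _.
  by rewrite mx_starM mx_starK.
have r0 : 0 < mxnorm H + 1 by have := bn_ge0 hB H; lra.
set r := mxnorm H + 1 in r0.
pose W : B := (r^-1)%:C *: H.
have Ws : mx_star W = W by rewrite mx_star_real Hs.
have pW : sos W.
  pose V : B := (Num.sqrt r^-1)%:C *: 1.
  suff -> : W = mx_star V * H * V by exact: sos_conj.
  have -> : mx_star V = V by rewrite mx_star_real mx_star1.
  rewrite -[V * H * V]/((V : B) * H * V) /V -scalerAl mul1r -scalerAr mulr1.
  by rewrite scalerA -rmorphM -expr2 sqr_sqrtr // invr_ge0 ltW.
have W1 : mxnorm W <= 1.
  rewrite (bnZ hB) ger0_norm ?invr_ge0 ?(ltW r0) // mulrC ler_pdivrMr //.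
  by rewrite mul1r /r; lra.
(* First root: [mxnorm W <= 1] bounds the powers of [W], so 1 - W is a square. *)
have [n|X Xs XX] := @mx_sqrt W (mxnorm 1 + 1) Ws.
  elim: n => [|n IHn]; first by rewrite lerDl.
  rewrite exprS (le_trans (bnM hB _ _)) // -[leRHS]mul1r.
  by rewrite ler_pM // (bn_ge0 hB).
have p1W : sos (1 - W) by rewrite -XX -{1}Xs; exact: sos_sqr.
have V1s : mx_star (1 - W) = 1 - W by rewrite mx_starB mx_star1 Ws.
(* Second root: the entries of (1 - W)^n have norm at most 1 because 1 - (1 - W)^(2n) is a sum of
   squares. *)
have [n|Y Ys YY] := @mx_sqrt (1 - W) (\sum_(i < k.+1) \sum_(j < k.+1) 1) V1s.
  apply: ler_sum => i _; apply: ler_sum => j _; apply: cnorm_entry_le1.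
  rewrite mx_starX // -exprD; apply: sos_contraction_pow => //.
  by rewrite subKr.
pose Z : B := (Num.sqrt r)%:C *: Y.
exists Z; have -> : mx_star Z = Z by rewrite mx_star_real Ys.
rewrite -[RHS]/((Z : B) * Z) /Z -scalerAl -scalerAr YY subKr !scalerA -!rmorphM.
by rewrite -expr2 sqr_sqrtr ?(ltW r0) // mulfV ?gt_eqF // scale1r.
Qed.

End MatrixAlgebra.

Lemma mx_positive_sum (R : realType) (T : cstarAlgType R) k n
    (N : 'I_n -> 'M[T]_k) : (0 < k)%N ->
  mx_positive (\sum_(i < n) mx_star (N i) *m N i).
Proof.
case: k N => // k N _; apply: (@mx_positive_sos R T k).
by exists [seq N i | i <- enum 'I_n]; rewrite big_map big_enum.
Qed.

(** * Positive functionals on cones *)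

Section ScalarForm.
Variables (R : realType) (V : lmodType R[i]) (f : V -> R[i]).
Hypothesis flin : forall c x y, f (c *: x + y) = c * f x + f y.

Lemma scalar_formD x y : f (x + y) = f x + f y.
Proof. by rewrite -[x in LHS]scale1r flin mul1r. Qed.

Lemma scalar_form0 : f 0 = 0.
Proof.
have := scalar_formD 0 0; rewrite addr0 => /eqP.
by rewrite -subr_eq0 opprD addNKr oppr_eq0 => /eqP.
Qed.

Lemma scalar_formZ c x : f (c *: x) = c * f x.
Proof. by rewrite -[c *: x]addr0 flin scalar_form0 addr0. Qed.

End ScalarForm.

Section ConeFunctional.
Variables (R : realType) (V : lmodType R[i]) (e : V).

Definition cone_without (M : set V) : Prop :=
  [/\ forall x y, M x -> M y -> M (x + y),
      forall (r : R) x, 0 <= r -> M x -> M (r%:C *: x) & ~ M (- e)].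

Lemma cone_without_maximal (C : set V) : cone_without C ->
  exists2 M, C `<=` M /\ cone_without M &
    forall B, M `<=` B -> cone_without B -> B = M.
Proof.
move=> hC.
(* Zorn's lemma is run on the sets whose union with [C] is admissible, so that the empty chain is
   bounded by virtue of [C] itself. *)
have [|A [hA Amax]] := @Zorn_bigcup V [set M | cone_without (C `|` M)].
  move=> F FP Ftot.
  have key x y : (C `|` \bigcup_(X in F) X) x -> (C `|` \bigcup_(X in F) X) y ->
      exists M, [/\ cone_without M, M `<=` C `|` \bigcup_(X in F) X, M x & M y].
    have CF X : F X -> C `|` X `<=` C `|` \bigcup_(X in F) X.
      by move=> FX; apply: setUS; exact: bigcup_sup.
    move=> [Cx|[X FX Xx]] [Cy|[Y FY Yy]].
    - by exists C; split=> //; exact: subsetUl.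
    - by exists (C `|` Y); split; [exact: FP|exact: CF|left|right].
    - by exists (C `|` X); split; [exact: FP|exact: CF|right|left].
    - have [XY|YX] := Ftot _ _ FX FY.
        by exists (C `|` Y); split; [exact: FP|exact: CF|right; exact: XY|right].
      by exists (C `|` X); split; [exact: FP|exact: CF|right|right; exact: YX].
  split=> [x y Cx Cy|r x r0 Cx|Ce].
  - by have [M [[MD _ _] MC Mx My]] := key x y Cx Cy; exact/MC/MD.
  - by have [M [[_ MZ _] MC Mx _]] := key x x Cx Cx; exact/MC/MZ.
  - by have [M [[_ _ Me] _ Mx _]] := key _ _ Ce Ce.
exists (C `|` A); first by split=> //; exact: subsetUl.
move=> B AB hB; apply/seteqP; split=> // x Bx.
apply: contrapT => nx; apply: (Amax B); last first.
  by rewrite /= (_ : C `|` B = B) //; apply/setUidPr => y Cy; apply: AB; left.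
split; first by move=> y Ay; apply: AB; right.
by move=> /(_ x Bx) Ax; apply: nx; right.
Qed.

Variable C : set V.
Hypothesis hC : cone_without C.
Hypothesis Ce : C e.
Hypothesis Cunit : forall x, exists t : R, C (t%:C *: e - x).

(** Let M be a maximal cone and g x the infimum of the t with t e - x in M. Then [g] is subadditive
    since M is a cone, odd since M contains x or -x, and g e = 1 since M omits -e. *)
Lemma cone_real_functional : exists g : V -> R,
  [/\ forall x y, g (x + y) = g x + g y,
      forall (r : R) x, g (r%:C *: x) = r * g x,
      forall x, C x -> 0 <= g x & g e = 1].
Proof.
have [M [CM [MD MZ Me]] Mmax] := cone_without_maximal hC.
have Mtot x : ~ M x -> M (- x).
  move=> nMx.
  have e0 : M e by exact: CM.
  have M0 : M 0 by have := MZ 0 e (lexx _) e0; rewrite scale0r.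
  (* If x is not in M, maximality puts -e in the cone [B] generated by M and x; solving -e = m + r x
     for -x places -x in M. *)
  pose B := [set z | exists m (r : R), [/\ M m, 0 <= r & z = m + r%:C *: x]].
  have [m [r [Mm r0 h]]] : B (- e).
    apply: contrapT => nB; apply: nMx.
    suff <- : B = M by exists 0, 1; rewrite add0r scale1r.
    apply: Mmax; first by move=> m Mm; exists m, 0; rewrite scale0r addr0.
    split=> [_ _ [m [r [Mm r0 ->]]] [n [s [Mn s0 ->]]]|r _ r0 [m [s [Mm s0 ->]]]|Be].
    - exists (m + n), (r + s); split; [exact: MD|exact: addr_ge0|].
      by rewrite rmorphD scalerDl addrACA.
    - exists (r%:C *: m), (r * s); split; [exact: MZ|exact: mulr_ge0|].
      by rewrite scalerDr scalerA rmorphM.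
    - exact: nB.
  move: r0 h; rewrite le_eqVlt => /predU1P[<-|r0].
    by rewrite scale0r addr0 => h; case: Me; rewrite h.
  move=> h.
  have -> : - x = (r^-1)%:C *: (m + e).
    have -> : m + e = - (r%:C *: x).
      by apply/eqP; rewrite -addr_eq0 addrAC -h addNr.
    by rewrite scalerN scalerA -rmorphM mulVf ?gt_eqF // scale1r.
  by apply: MZ; [rewrite invr_ge0 ltW|exact: MD].
pose D x := [set t : R | M (t%:C *: e - x)].
have Mge0 t : M (t%:C *: e) -> 0 <= t.
  rewrite leNgt => Mt; apply/negP => t0; apply: Me.
  have := MZ (- t^-1) _ _ Mt; rewrite scalerA -rmorphM mulNr mulVf ?lt_eqF //.
  by rewrite rmorphN1 scaleN1r; apply; rewrite oppr_ge0 invr_le0 ltW.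
have Dge x t s : D x t -> D (- x) s -> 0 <= t + s.
  move=> Dt Ds; apply: Mge0; have := MD _ _ Dt Ds.
  by rewrite opprK addrACA addNr addr0 -scalerDl -rmorphD.
have Dinf x : has_inf (D x).
  split; first by have [t Ct] := Cunit x; exists t; exact: CM.
  have [s Cs] := Cunit (- x); exists (- s) => t Dt.
  by rewrite -subr_ge0 opprK; apply: Dge Dt (CM _ Cs).
pose g x := inf (D x).
have gle x t : D x t -> g x <= t by move=> Dt; apply: ge_inf => //; case: (Dinf x).
have leg x a : (forall t, D x t -> a <= t) -> a <= g x.
  by move=> h; apply: lb_le_inf => //; case: (Dinf x).
have gadh x d : 0 < d -> exists2 t, D x t & t < g x + d.
  by move=> d0; exact: inf_adherent.
clearbody g.
have gD_le x y : g (x + y) <= g x + g y.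
  apply/ler_addgt0Pr => d d0; have d2 : 0 < d / 2 by rewrite divr_gt0.
  have [t Dt ht] := gadh x _ d2.
  have [s Ds hs] := gadh y _ d2.
  apply: (@le_trans _ _ (t + s)); last by lra.
  by apply: gle; rewrite /D /= rmorphD scalerDl opprD addrACA; exact: MD.
have gN x : g (- x) = - g x.
  apply/eqP; rewrite eq_le; apply/andP; split; last first.
    rewrite lerNl; apply: (leg) => t Dt; rewrite lerNl; apply: (leg).
    by move=> s Ds; rewrite lerNl -subr_ge0 opprK; exact: Dge Dt Ds.
  apply/ler_addgt0Pr => d d0.
  suff : D (- x) (d - g x) by move=> /gle; rewrite addrC.
  (* g x - d lies below the infimum, so this element is not in M and its negative is. *)
  have /Mtot : ~ M ((g x - d)%:C *: e - x) by move=> /gle; lra.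
  rewrite (_ : - (_ - _) = (d - g x)%:C *: e - - x) //.
  by rewrite opprB opprK addrC -scaleNr -rmorphN opprB.
have gD x y : g (x + y) = g x + g y.
  apply/eqP; rewrite eq_le gD_le /= -lerN2 -gN !opprD.
  by rewrite -!gN gD_le.
have gZ_le (r : R) x : 0 < r -> g (r%:C *: x) <= r * g x.
  move=> r0; rewrite mulrC -ler_pdivrMr //; apply: (leg).
  move=> t Dt; rewrite ler_pdivrMr //; apply: gle.
  by rewrite /D /= mulrC rmorphM -scalerA -scalerBr; apply: MZ => //; exact: ltW.
have gZ_pos (r : R) x : 0 < r -> g (r%:C *: x) = r * g x.
  move=> r0; apply/eqP; rewrite eq_le gZ_le //=.
  have := @gZ_le r^-1 (r%:C *: x); rewrite invr_gt0 => /(_ r0).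
  rewrite scalerA -rmorphM mulVf ?gt_eqF // scale1r mulrC.
  by rewrite ler_pdivlMr // mulrC.
exists g; split=> //.
- move=> r x; case: (ltgtP r 0) => [r0|r0|->]; last 2 first.
  + exact: gZ_pos.
  + have := gD 0 0; rewrite addr0 scale0r mul0r => /eqP.
    by rewrite -subr_eq0 opprD addNKr oppr_eq0 => /eqP.
  + have := @gZ_pos (- r) x; rewrite oppr_gt0 r0 => /(_ isT).
    by rewrite rmorphN scaleNr gN mulNr => /oppr_inj.
- move=> x Cx; rewrite -oppr_le0 -gN; apply: gle.
  by rewrite /D /= scale0r sub0r opprK; exact: CM.
- apply/eqP; rewrite eq_le; apply/andP; split.
    apply: gle; rewrite /D /= scale1r subrr.
    by have := MZ 0 e (lexx _) (CM _ Ce); rewrite scale0r.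
  apply: (leg).
  move=> t Dt; rewrite -subr_ge0; apply: Mge0.
  by rewrite rmorphB scalerBl scale1r.
Qed.

(** Takes the complex-linear functional whose real part is [g]. *)
Lemma cone_functional : exists f : V -> R[i],
  [/\ forall c x y, f (c *: x + y) = c * f x + f y,
      forall x, C x -> 0 <= complex.Re (f x) & complex.Re (f e) = 1].
Proof.
have [g [gD gZ g0 g1]] := cone_real_functional.
exists (fun x => g x +i* (- g ('i *: x))); split=> //.
have gc (a b : R) x : g ((a +i* b) *: x) = a * g x + b * g ('i *: x).
  have -> : a +i* b = a%:C + b%:C * 'i.
    by apply/eqP; rewrite eq_complex /=; apply/andP; split; apply/eqP; ring.
  by rewrite scalerDl gD gZ -scalerA gZ.
move=> [a b] x y; rewrite scalerDr scalerA.
have -> : 'i * (a +i* b) = (- b) +i* a :> R[i].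
  by apply/eqP; rewrite eq_complex /=; apply/andP; split; apply/eqP; ring.
rewrite !gD (gc a b) (gc (- b) a); apply/eqP; rewrite eq_complex /=.
by apply/andP; split; apply/eqP; ring.
Qed.

End ConeFunctional.

(** * States on matrix algebras *)

Section StateLinear.
Variables (R : realType) (T : cstarAlgType R) (k : nat) (f : 'M[T]_k -> R[i]).
Hypothesis hf : is_state f.

Lemma stateD M N : f (M + N) = f M + f N.
Proof.
case: hf => flin _ _; rewrite -[f M]mul1r -flin; congr (f (_ + _)).
by apply/matrixP => i j; rewrite !mxE scale1r.
Qed.

Lemma state0 : f 0 = 0.
Proof.
have := stateD 0 0; rewrite addr0 => /eqP.
by rewrite -subr_eq0 opprD addNKr oppr_eq0 => /eqP.
Qed.

Lemma stateZ c M : f (map_mx ( *:%R c) M) = c * f M.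
Proof. by case: hf => flin _ _; rewrite -[map_mx _ _]addr0 flin state0 addr0. Qed.

End StateLinear.

Section States.
Variables (R : realType) (T : cstarAlgType R).

(** [C] consists of the elements with positive real part; it omits -1 because the unit has norm 1,
    and a norm bound makes 1 an order unit. *)
Lemma state_exists : exists f : 'M[T]_1 -> R[i], is_state f.
Proof.
pose C := [set x : T | posC (x + star x)].
have hN := cnorm_banach T.
have ss (x : T) : star (x + star x) = x + star x by rewrite starD starK addrC.
have [|||f [flin fpos f1]] := @cone_functional R T 1 C.
- split=> [x y Cx Cy|r x r0 Cx|].
  + by rewrite /C /= starD addrACA; exact: posCD.
  + by rewrite /C /= star_real -scalerDr; exact: posCZ.
  + rewrite /C /= starN star1 => -[_ [t t0]].
    have -> : t%:C *: 1 - (- 1 - 1) = (t + 2)%:C *: 1 :> T.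
      by rewrite rmorphD scalerDl rmorph_nat scaler_nat mulr2n -opprD opprK.
    by rewrite (bnZ hN) cnorm1 mulr1 ger0_norm ?addr_ge0 //; lra.
- rewrite /C /= star1; apply: posCD;
  by have := @posC_sqr R T 1 (star1 T); rewrite mulr1.
- move=> x; exists (cnorm (x + star x) / 2).
  have := posC_order_unit (ss x) (lexx _).
  rewrite /C /= starB star_real star1 addrACA -opprD -scalerDl -rmorphD.
  by have -> : forall r : R, r / 2 + r / 2 = r by move=> r; field.
have posD y : posC y -> 0 <= complex.Re (f y).
  by move=> py; apply: fpos; rewrite /C /=; case: (py) => -> _; exact: posCD.
have fZ := scalar_formZ flin.
have pos y : posC y -> 0 <= f y.
  move=> py; have := posD y py.
  (* Both i y and -i y are skew-adjoint, hence in [C]; this makes the imaginary part of f y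
     vanish. *)
  have pi (c : R[i]) : conjc c = - c -> 0 <= complex.Re (f (c *: y)).
    move=> cc; apply: fpos; rewrite /C /= starZ cc; case: (py) => -> _.
    by rewrite scaleNr subrr; exact: posC0.
  have /pi : conjc ('i : R[i]) = - 'i.
    by apply/eqP; rewrite eq_complex /= oppr0 !eqxx.
  have /pi : conjc (- 'i : R[i]) = - - 'i.
    by apply/eqP; rewrite eq_complex /= !oppr0 !eqxx.
  rewrite scaleNr -scaleN1r !fZ; case: (f y) => a b /=.
  rewrite !(mul0r, mulr0, oppr0, subr0, addr0, mul1r, sub0r, mulN1r) => h1 h2 h3.
  by rewrite lecE /=; apply/andP; split=> //; apply/eqP; lra.
exists (fun M => f (M ord0 ord0)); split.
- by move=> c M N; rewrite !mxE flin.
- move=> M [N ->]; apply: pos; rewrite mxE big_ord1 !mxE; exact: posC_star_mul.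
- rewrite mxE /=.
  have := pos 1; rewrite -[X in posC X]mulr1 -{1}(star1 T).
  move=> /(_ (posC_star_mul _)).
  by move: f1; case: (f 1) => a b /= ->; rewrite lecE /= => /andP[/eqP -> _].
Qed.

(** Each row of the rectangular N, completed by zero rows to a square matrix [E i], contributes one
    square to N^* N. *)
Lemma state_sub_ge0 k (f : 'M[T]_k -> R[i]) p (N : 'M[T]_(p, k)) : (0 < k)%N ->
  is_state f -> 0 <= f (mx_star N *m N).
Proof.
case: k f N => // k f N _ hf.
pose E i : 'M[T]_k.+1 := \matrix_(a, b) if a == ord0 then N i b else 0.
have -> : mx_star N *m N = \sum_i mx_star (E i) *m E i.
  apply/matrixP => a b; rewrite summxE !mxE; apply: eq_bigr => i _.
  rewrite !mxE (bigD1 ord0) //= !mxE eqxx big1 ?addr0 // => j /negPf j0.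
  by rewrite !mxE j0 mulr0.
rewrite (big_morph f (stateD hf) (state0 hf)); apply: sumr_ge0 => i _.
by case: hf => _ fpos _; apply: fpos; exists (E i).
Qed.

End States.

(** * Completely positive maps and matrix tests *)

Section CPConvex.
Variables (R : realType) (A T : cstarAlgType R) (S : opSystem A).

(** If Phi_i sends M to N_i^* N_i, the combination sends M to the sum of the squares of the N_i a_i,
    which is positive by [mx_positive_sum]. *)
Lemma CP_cstar_convex : cstar_convex (CP T S).
Proof.
split=> // n a Phi n0 hPhi _; split.
  move=> c x y; rewrite /cstar_comb scaler_sumr -big_split; apply: eq_bigr => i _.
  by case: (hPhi i) => -> _; rewrite mulrDr mulrDl -scalerAr -scalerAl.
move=> k k0 M pM.
have /choice[N hN] : forall i, exists N : 'M[T]_k,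
    map_mx (Phi i) M = mx_star N *m N.
  by move=> i; case: (hPhi i) => _ /(_ k k0 M pM).
suff -> : map_mx (cstar_comb a Phi) M = \sum_(i < n)
    mx_star (map_mx (fun x => x * a i) (N i)) *m map_mx (fun x => x * a i) (N i).
  exact: mx_positive_sum.
apply/matrixP => p q; rewrite summxE !mxE; apply: eq_bigr => i _.
have /matrixP/(_ p q) := hN i; rewrite !mxE => ->.
rewrite mulr_sumr mulr_suml; apply: eq_bigr => l _.
by rewrite !mxE starM !mulrA.
Qed.

Lemma cconv_sub_CP (K : set (S -> T)) : K `<=` CP T S -> cconv K `<=` CP T S.
Proof. by move=> hK; apply: smallest_sub => //; exact: CP_cstar_convex. Qed.

(** Ordinary convex combinations have the C*-coefficients sqrt r and sqrt (1 - r) times the unit. *)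
Lemma cconv_convex (K : set (S -> T)) (r : R) Psi1 Psi2 : 0 <= r <= 1 ->
  cconv K Psi1 -> cconv K Psi2 ->
  cconv K (r%:C *: Psi1 + (1 - r)%:C *: Psi2).
Proof.
move=> /andP[r0 r1] h1 h2 X [hX KX].
have X1 : X Psi1 by exact: h1.
have X2 : X Psi2 by exact: h2.
pose q (i : 'I_2) := if i == ord0 then r else 1 - r.
have q0 i : 0 <= q i by rewrite /q; case: ifP => _ //; rewrite subr_ge0.
pose a (i : 'I_2) : T := (Num.sqrt (q i))%:C *: 1.
pose Phi (i : 'I_2) := if i == ord0 then Psi1 else Psi2.
have aE i x : star (a i) * x * a i = (q i)%:C *: x.
  rewrite /a star_real star1 -scalerAl mul1r -scalerAr mulr1 scalerA -rmorphM.
  by rewrite -expr2 sqr_sqrtr.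
have <- : cstar_comb a Phi = r%:C *: Psi1 + (1 - r)%:C *: Psi2.
  by apply/funext => s; rewrite /cstar_comb big_ord_recl big_ord1 !aE.
case: hX => _; apply=> //; first by move=> i; rewrite /Phi; case: ifP.
under eq_bigr => i _ do rewrite -[star (a i)]mulr1 aE.
by rewrite big_ord_recl big_ord1 -scalerDl -rmorphD /q /= addrC subrK scale1r.
Qed.

End CPConvex.

(** * Linear combinations of matrix tests *)

Section Tests.
Variables (R : realType) (A T : cstarAlgType R) (S : opSystem A).
Implicit Types (t : matrix_test S (T := T)) (Phi Psi : S -> T).

Lemma test_evalP t c Phi Psi :
  test_eval t (c *: Phi + Psi) = c * test_eval t Phi + test_eval t Psi.
Proof.
rewrite /test_eval; case: (mt_state t) => flin _ _; rewrite -flin; congr mt_f.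
by apply/matrixP => i j; rewrite !mxE.
Qed.

Lemma test_evalB t Phi Psi :
  test_eval t (Phi - Psi) = test_eval t Phi - test_eval t Psi.
Proof. by rewrite addrC -scaleN1r test_evalP mulN1r addrC. Qed.

(** The factor goes into the matrix, since the state must stay normalized. *)
Lemma scale_test t c : exists t', forall Phi, linear Phi ->
  test_eval t' Phi = c * test_eval t Phi.
Proof.
exists (MatrixTest (mt_k_gt0 t) (mt_state t) (map_mx ( *:%R c) (mt_s t))).
move=> Phi hPhi; rewrite /test_eval /= -stateZ; last exact: mt_state.
congr mt_f; apply/matrixP => i j; rewrite !mxE.
have Phi0 : Phi 0 = 0.
  have := hPhi (-1) 0 0; rewrite scaler0 addr0 scaleN1r addNr; exact.
by rewrite -[c *: _]addr0 hPhi Phi0 addr0.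
Qed.

(** The diagonal blocks of N^* N are squares of the rectangular column blocks of N; the factor 1/2
    normalizes. *)
Lemma mean_state k1 k2 (f1 : 'M[T]_k1 -> R[i]) (f2 : 'M[T]_k2 -> R[i]) :
  (0 < k1)%N -> (0 < k2)%N -> is_state f1 -> is_state f2 ->
  is_state (fun M : 'M[T]_(k1 + k2) =>
    2^-1 * (f1 (ulsubmx M) + f2 (drsubmx M))).
Proof.
move=> k10 k20 hf1 hf2; split.
- move=> c M N; case: (hf1) (hf2) => f1l _ _ [f2l _ _].
  have -> : ulsubmx (map_mx ( *:%R c) M + N) =
      map_mx ( *:%R c) (ulsubmx M) + ulsubmx N.
    by apply/matrixP => i j; rewrite !mxE.
  have -> : drsubmx (map_mx ( *:%R c) M + N) =
      map_mx ( *:%R c) (drsubmx M) + drsubmx N.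
    by apply/matrixP => i j; rewrite !mxE.
  by rewrite f1l f2l; ring.
- move=> M [N ->]; rewrite mulr_ge0 ?invr_ge0 // addr_ge0 //.
  + have -> : ulsubmx (mx_star N *m N) = mx_star (lsubmx N) *m lsubmx N.
      by apply/matrixP => i j; rewrite !mxE; apply: eq_bigr => l _; rewrite !mxE.
    exact: state_sub_ge0.
  + have -> : drsubmx (mx_star N *m N) = mx_star (rsubmx N) *m rsubmx N.
      by apply/matrixP => i j; rewrite !mxE; apply: eq_bigr => l _; rewrite !mxE.
    exact: state_sub_ge0.
- rewrite scalar_mx_block block_mxKul block_mxKdr.
  by case: hf1 hf2 => _ _ -> [_ _ ->]; rewrite -mulr2n mulVf // pnatr_eq0.
Qed.

Lemma mean_test t1 t2 : exists t, forall Phi,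
  test_eval t Phi = 2^-1 * (test_eval t1 Phi + test_eval t2 Phi).
Proof.
have k0 : (0 < mt_k t1 + mt_k t2)%N by rewrite addn_gt0 mt_k_gt0.
have hf := mean_state (mt_k_gt0 t1) (mt_k_gt0 t2) (mt_state t1) (mt_state t2).
exists (MatrixTest k0 hf (block_mx (mt_s t1) 0 0 (mt_s t2))) => Phi.
by rewrite /test_eval /= map_block_mx block_mxKul block_mxKdr.
Qed.

Lemma zero_test : exists t, forall Phi, linear Phi -> test_eval t Phi = 0.
Proof.
have [f hf] := state_exists T.
have [t ht] := scale_test (MatrixTest (ltn0Sn 0) hf 0) 0.
by exists t => Phi /ht ->; rewrite mul0r.
Qed.

Lemma combine_tests (I : Type) (r : seq I) (t : I -> matrix_test S (T := T))
    (c : I -> R[i]) : exists t0 (q : R), 0 < q /\ forall Phi, linear Phi ->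
    test_eval t0 Phi = q%:C * \sum_(i <- r) c i * test_eval (t i) Phi.
Proof.
elim: r => [|i r [t0 [q [q0 ht0]]]].
  have [t0 ht0] := zero_test; exists t0, 1; split=> // Phi hPhi.
  by rewrite big_nil mulr0 ht0.
(* Scaling the head by [q] in advance lets the average with [t0] carry the common factor q / 2. *)
have [t1 ht1] := scale_test (t i) (q%:C * c i).
have [t2 ht2] := mean_test t1 t0; exists t2, (2^-1 * q); split.
  by rewrite mulr_gt0 // invr_gt0.
move=> Phi hPhi; rewrite ht2 ht1 // ht0 // big_cons rmorphM fmorphV rmorph_nat /=.
by ring.
Qed.

Lemma cp_span_linear Phi : cp_span Phi -> linear Phi.
Proof.
move=> [n [c [Psi [hPsi ->]]]] a x y.
rewrite !fct_sumE scaler_sumr -big_split; apply: eq_bigr => i _.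
case: (hPsi i) => hlin _.
by rewrite [LHS]/GRing.scale /= hlin scalerDr !scalerA [c i * a]mulrC.
Qed.

Lemma CP_cp_span Phi : CP T S Phi -> cp_span Phi.
Proof.
move=> hPhi; exists 1%N, (fun=> 1), (fun=> Phi); split=> //.
by rewrite big_ord1 scale1r.
Qed.

End Tests.

(** * Separation and the topology tau *)

Lemma normc_leD (R : realType) (x y : R[i]) :
  Normc.normc (x + y) <= Normc.normc x + Normc.normc y.
Proof. exact: le_normcD. Qed.

Lemma normc_opp (R : realType) (x : R[i]) : Normc.normc (- x) = Normc.normc x.
Proof. exact: normcN. Qed.

Lemma normc_ge_absRe (R : realType) (x : R[i]) :
  `|complex.Re x| <= Normc.normc x.
Proof. by have := normc_ge_Re x; rewrite lecR. Qed.

(** * Separation of a convex set from a polydisc in finite dimension *)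

Section Separation.
Variables (R : realType) (I : finType) (eps : I -> R) (D : set (I -> R[i]^o)).
Hypothesis eps_gt0 : forall i, 0 < eps i.
Hypothesis Dconvex : forall (r : R) x y, 0 <= r <= 1 -> D x -> D y ->
  D (r%:C *: x + (1 - r)%:C *: y).
Hypothesis Deps : forall x, D x -> exists i, eps i <= Normc.normc (x i).

Let ball0 := [set b : I -> R[i]^o | forall i, Normc.normc (b i) < eps i].

Lemma ball0_convex (r : R) x y : 0 <= r <= 1 -> ball0 x -> ball0 y ->
  ball0 (r%:C *: x + (1 - r)%:C *: y).
Proof.
move=> /andP[r0 r1] hx hy i; apply: le_lt_trans (normc_leD _ _) _.
rewrite !Normc.normcM !normc_real !ger0_norm ?subr_ge0 //.
have := hy i; have := hx i.
move: (Normc.normc (x i)) (Normc.normc (y i)) => b a hb ha.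
move: r0; rewrite le_eqVlt => /predU1P[<-|r0].
  by rewrite mul0r add0r subr0 mul1r.
have h1 : r * b < r * eps i by rewrite ltr_pM2l.
have h2 : (1 - r) * a <= (1 - r) * eps i by rewrite ler_wpM2l ?subr_ge0 // ltW.
by lra.
Qed.

Lemma ball0_absorbing (x : I -> R[i]^o) :
  exists2 r : R, 0 < r & ball0 (r%:C *: x).
Proof.
pose s := \sum_i Normc.normc (x i) / eps i.
have n0 i : 0 <= Normc.normc (x i) / eps i.
  by rewrite divr_ge0 ?(ltW (eps_gt0 i)) //; case: (x i) => a b; exact: sqrtr_ge0.
have s0 : 0 < 1 + s by rewrite ltr_pwDl // sumr_ge0.
exists (1 + s)^-1; first by rewrite invr_gt0.
move=> i; rewrite Normc.normcM normc_real ger0_norm ?invr_ge0 ?(ltW s0) //.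
rewrite mulrC ltr_pdivrMr // -ltr_pdivrMl // mulrC.
rewrite /s (bigD1 i) //= addrCA ltrDl ltr_pwDl // sumr_ge0 //.
Qed.

Lemma ball0_N x : ball0 x -> ball0 (- x).
Proof. by move=> hx i; rewrite normc_opp; exact: hx. Qed.

(** A Hahn-Banach argument: the functional is positive on the cone [C] generated by [D] + [ball0],
    with order unit [z0]. *)
Lemma separate_from_0 z0 : D z0 -> exists (c : I -> R[i]) (d : R), 0 < d /\
  forall x, D x -> d <= complex.Re (\sum_i c i * x i).
Proof.
move=> Dz0.
pose C := [set w | exists (r : R) z b,
  [/\ 0 <= r, D z, ball0 b & w = r%:C *: (z + b)]].
have ball00 : ball0 0 by move=> i; rewrite Normc.normc0.
have [|||f [flin fC f1]] := @cone_functional R (I -> R[i]^o) z0 C.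
- split.
  + move=> _ _ [r [z [b [r0 Dz hb ->]]]] [s [y [a [s0 Dy ha ->]]]].
    have := addr_ge0 r0 s0; rewrite le_eqVlt => /predU1P[/esym/eqP|rs0].
      rewrite paddr_eq0 // => /andP[/eqP -> /eqP ->].
      by exists 0, z, b; rewrite !scale0r addr0.
    pose p := r / (r + s).
    have p01 : 0 <= p <= 1.
      by rewrite /p divr_ge0 ?addr_ge0 //= ler_pdivrMr // mul1r lerDl.
    exists (r + s), (p%:C *: z + (1 - p)%:C *: y), (p%:C *: b + (1 - p)%:C *: a).
    split; [exact: ltW|exact: Dconvex|exact: ball0_convex|].
    have e1 : r = (r + s) * p by rewrite /p mulrC divfK // gt_eqF.
    have e2 : s = (r + s) * (1 - p) by rewrite mulrBr mulr1 -e1 addrAC subrr add0r.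
    rewrite addrACA -!scalerDr [RHS]scalerDr !scalerA -!rmorphM /=.
    by rewrite -e1 -e2.
  + move=> r _ r0 [s [z [b [s0 Dz hb ->]]]].
    by exists (r * s), z, b; rewrite mulr_ge0 // scalerA rmorphM.
  + move=> [r [z [b [r0 Dz hb h]]]].
    have r1 : 0 < 1 + r by rewrite ltr_pwDl.
    (* With this weight, -z0 = r (z + b) makes p z0 + (1 - p) z a multiple of -b inside the
       polydisc, against [Deps]. *)
    pose p := (1 + r)^-1.
    have p0 : 0 <= p by rewrite invr_ge0 ltW.
    have p01 : 0 <= p <= 1 by rewrite p0 invf_le1 // lerDl.
    case: (Deps (Dconvex p01 Dz0 Dz)) => i.
    have e1 : 1 - p = p * r.
      by rewrite /p; field; rewrite gt_eqF.
    have -> : p%:C *: z0 + (1 - p)%:C *: z = p%:C *: 0 + (1 - p)%:C *: (- b).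
      rewrite e1 rmorphM -!scalerA -!scalerDr; congr (_ *: _).
      by rewrite -[z0]opprK h scalerDr scalerN opprD addrAC addNr.
    by rewrite leNgt ball0_convex //; exact: ball0_N.
- by exists 1, z0, 0; rewrite addr0 scale1r.
- move=> x; have [r r0 hr] := ball0_absorbing (- x).
  exists r^-1, r^-1, z0, (r%:C *: - x); split=> //; first by rewrite invr_ge0 ltW.
  by rewrite scalerDr scalerA -rmorphM mulVf ?gt_eqF // scale1r.
have fD := scalar_formD flin; have fZ := scalar_formZ flin.
pose e i : I -> R[i]^o := fun j => (j == i)%:R.
have fE x : f x = \sum_i f (e i) * x i.
  have xE : x = \sum_i x i *: e i.
    apply/funext => j; rewrite fct_sumE (bigD1 j) //= big1 => [|i ij].
      by rewrite addr0 -[RHS]/(x j * (j == j)%:R) eqxx mulr1.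
    by rewrite -[LHS]/(x i * (j == i)%:R) eq_sym (negPf ij) mulr0.
  rewrite {1}xE (big_morph f fD (scalar_form0 flin)); apply: eq_bigr => i _.
  by rewrite fZ mulrC.
(* The margin: x - d z0 lies in [C] and f z0 has real part 1, so f x has real part at least d. *)
have [d d0 hd] := ball0_absorbing (- z0).
exists (fun i => f (e i)), d; split=> // x Dx; rewrite -fE.
have : C (x + d%:C *: - z0) by exists 1, x, (d%:C *: - z0); rewrite scale1r.
move=> /fC; rewrite fD scalerN -scaleNr -rmorphN fZ.
case: (f x) (f z0) f1 => a b [a' b'] /= ->; lra.
Qed.

End Separation.

(** * Neighbourhoods, closures and support functions *)

Section Topology.
Variables (R : realType) (A T : cstarAlgType R) (S : opSystem A).
Implicit Types (t : matrix_test S (T := T)) (Phi : @Espace R A T S).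

Lemma nbhs_test_ball t Phi (e : R) : 0 < e ->
  nbhs Phi [set Psi : @Espace R A T S | test_seminorm t (Psi - Phi) < e].
Proof.
move=> e0; set B := [set Psi | _].
have hB : tau_balls B by exists t, Phi, e.
rewrite nbhsE; exists B => //; split; last first.
  by rewrite /B /= /test_seminorm test_evalB subrr Normc.normc0.
exists [set B]; last by rewrite bigcup_set1.
by move=> _ ->; exact: (@finI_from1 _ _ (@tau_balls R A T S) id).
Qed.

(** Subbasic balls have arbitrary centres; each is replaced by a ball around [Phi] whose radius is
    reduced by the distance of the centres. *)
Lemma nbhs_tests Phi (B : set (@Espace R A T S)) : nbhs Phi B ->
  exists (I : finType) (t : I -> matrix_test S (T := T)) (e : I -> R),
    (forall i, 0 < e i) /\
    forall Psi, (forall i, test_seminorm (t i) (Psi - Phi) < e i) -> B Psi.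
Proof.
rewrite nbhsE => -[U [[D DU <-] [X DX XPhi]] UB].
have [F Fsub XE] : exists2 F : {fset set (@Espace R A T S)},
    {subset F <= @tau_balls R A T S} & \bigcap_(Y in [set` F]) Y = X := DU _ DX.
have /choice[t ht] : forall i : F, exists te : matrix_test S (T := T) * R,
    0 < te.2 /\ forall Psi, test_seminorm te.1 (Psi - Phi) < te.2 -> fsval i Psi.
  move=> i; have /set_mem[t [Phi0 [e [e0 iE]]]] := Fsub _ (fsvalP i).
  have : fsval i Phi by move: XPhi; rewrite -XE; apply; exact: fsvalP.
  rewrite iE /= /test_seminorm => he.
  exists (t, e - Normc.normc (test_eval t (E_val Phi - E_val Phi0))).
  rewrite subr_gt0; split=> // Psi /=; rewrite !test_evalB ltrBrDr => h.
  apply: le_lt_trans h; apply: le_trans (normc_leD _ _).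
  by rewrite addrA subrK.
exists F, (fun i => (t i).1), (fun i => (t i).2).
split=> [i|Psi hPsi]; first by case: (ht i).
apply: UB; exists X => //.
suff : (\bigcap_(Y in [set` F]) Y) Psi by rewrite XE; exact.
move=> Y YF.
by case: (ht [` YF]%fset) => _; apply; exact: hPsi.
Qed.

(** Finitely many tests witness that [Phi0] is outside the closure; their values map [X] to a convex
    set off a polydisc, and the separating functional is realized by one test. *)
Lemma closure_separation (X : set (S -> T)) Phi0 : X `<=` CP T S ->
  (forall (r : R) x y, 0 <= r <= 1 -> X x -> X y ->
    X (r%:C *: x + (1 - r)%:C *: y)) ->
  ~ tau_closure X Phi0 ->
  exists t (d : R), 0 < d /\ forall Psi, X Psi ->
    complex.Re (test_eval t Psi) + d <= complex.Re (test_eval t Phi0).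
Proof.
move=> XCP Xconv nX.
have [B hB BX] : exists2 B, nbhs Phi0 B & forall Psi, B Psi -> ~ X (E_val Psi).
  apply: contrapT => h; apply: nX => B hB; apply: contrapT => h'.
  by apply: h; exists B => // Psi BPsi XPsi; apply: h'; exists Psi.
have [I [t [e [e0 tB]]]] := nbhs_tests hB.
have lin Psi : X Psi -> linear Psi by move=> /XCP[].
have lin0 : linear (E_val Phi0).
  by apply: cp_span_linear; have := E_valP Phi0; rewrite inE.
pose v (Psi : S -> T) : I -> R[i]^o :=
  fun i => test_eval (t i) Psi - test_eval (t i) (E_val Phi0).
(* For empty [X] any test serves; one exists because [T] has a state. *)
have [[Psi1 X1]|X0] := pselect (exists Psi, X Psi); last first.
  have [t0 _] := @zero_test R A T S; exists t0, 1; split=> // Psi XPsi.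
  by case: X0; exists Psi.
have [c [d [d0 hcd]]] : exists (c : I -> R[i]) (d : R), 0 < d /\
    forall w, [set v Psi | Psi in X] w -> d <= complex.Re (\sum_i c i * w i).
  apply: (separate_from_0 e0); last by exists Psi1.
    move=> r _ _ hr [x Xx <-] [y Xy <-].
    exists (r%:C *: x + (1 - r)%:C *: y); first exact: Xconv.
    apply/funext => i; rewrite /v test_evalP -[(1 - r)%:C *: y]addr0 test_evalP.
    have -> : test_eval (t i) 0 = 0.
      by rewrite -(subrr (E_val Phi0)) test_evalB subrr.
    rewrite -[RHS]/(r%:C * (_ - _) + (1 - r)%:C * (_ - _)) rmorphB rmorph1.
    by ring.
  move=> _ [Psi XPsi <-]; apply: contrapT => h.
  have spanPsi : E_val (EElt (mem_set (CP_cp_span (XCP _ XPsi)))) = Psi by [].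
  apply: (BX (EElt (mem_set (CP_cp_span (XCP _ XPsi))))) => //; apply: tB => i.
  rewrite /test_seminorm /= test_evalB ltNge; apply/negP => hi.
  by apply: h; exists i.
(* The sign is reversed so that [Phi0] gets the larger value; [q] rescales the margin. *)
have [t0 [q [q0 ht0]]] := combine_tests (index_enum I) t (fun i => - c i).
exists t0, (q * d); split; first exact: mulr_gt0.
move=> Psi XPsi; rewrite !ht0 //; last exact: lin.
have /hcd : [set v Psi | Psi in X] (v Psi) by exists Psi.
have -> : \sum_i c i * v Psi i = \sum_i - c i * test_eval (t i) (E_val Phi0) -
    \sum_i - c i * test_eval (t i) Psi.
  by rewrite -sumrB; apply: eq_bigr => i _; rewrite /v; ring.
case: (\sum_i _) (\sum_i _) => a1 b1 [a2 b2] /=.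
by rewrite !mul0r !subr0 -mulrDr ler_pM2l //; lra.
Qed.

(** Each test is continuous for tau, so an element of [cconv K] is approximated by [cconv L] up to
    [e] on the given test. *)
Lemma support_fun_le_closure (K L : set (S -> T)) t :
  K `<=` CP T S -> L `<=` CP T S ->
  tau_closure (cconv K) `<=` tau_closure (cconv L) ->
  (support_fun K t <= support_fun L t)%E.
Proof.
move=> hK hL KL; apply: ge_ereal_sup => _ [Psi KPsi <-].
have hPsi := mem_set (CP_cp_span (cconv_sub_CP hK KPsi)).
have /KL cl : tau_closure (cconv K) (EElt hPsi) by exact: subset_closure.
apply/lee_addgt0Pr => e e0.
have [Psi' [LPsi']] := cl _ (nbhs_test_ball t (EElt hPsi) e0).
rewrite /= /test_seminorm test_evalB => h.
apply: (@le_trans _ _ ((complex.Re (test_eval t (E_val Psi')))%:E + e%:E)%E).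
  rewrite lee_fin -lerBlDl.
  have := le_lt_trans (normc_ge_absRe _) h.
  case: (test_eval t _) (test_eval t _) => a b [a' b'] /=.
  by rewrite ltr_norml => /andP[h1 _]; lra.
by rewrite leeD2r //; apply: ereal_sup_ubound; exists (E_val Psi').
Qed.

(** A point of [cconv L] outside the closure of [cconv K] would, by separation, give a test at which
    the support function of [L] exceeds that of [K]. *)
Lemma closure_sub_support_fun (K L : set (S -> T)) :
  K `<=` CP T S -> L `<=` CP T S ->
  (forall t, support_fun L t <= support_fun K t)%E ->
  tau_closure (cconv L) `<=` tau_closure (cconv K).
Proof.
move=> hK hL LK.
suff h : [set Phi : @Espace R A T S | cconv L Phi] `<=` tau_closure (cconv K).
  move=> Phi /(closureS h); rewrite /tau_closure -(closure_id _).1 //.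
  exact: closed_closure.
move=> Phi LPhi; apply: contrapT => /(closure_separation (cconv_sub_CP hK)).
case=> [r x y hr hx hy|t [d [d0 hd]]]; first exact: cconv_convex.
have h1 : (support_fun K t <= (complex.Re (test_eval t (E_val Phi)) - d)%:E)%E.
  by apply: ge_ereal_sup => _ [Psi KPsi <-]; rewrite lee_fin lerBrDr hd.
have h2 : ((complex.Re (test_eval t (E_val Phi)))%:E <= support_fun L t)%E.
  by apply: ereal_sup_ubound; exists (E_val Phi).
have := le_trans (le_trans h2 (LK t)) h1; rewrite lee_fin; lra.
Qed.

End Topology.

Theorem corollary4p5 (R : realType) (A T : cstarAlgType R) (S : opSystem A)
    (K L : set (S -> T)) (hK : K `<=` CP T S) (hL : L `<=` CP T S) :
  tau_closure (cconv K) = tau_closure (cconv L) <->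
  (forall t : matrix_test S, support_fun K t = support_fun L t).
Proof.
split=> [h t|h].
  by apply/eqP; rewrite eq_le !support_fun_le_closure // h.
by apply/seteqP; split; apply: closure_sub_support_fun => // t; rewrite h.
Qed.
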